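(* There exists an absolute constant $C>0$ such that the following holds. Let $n\ge 2$ and let $K$ and $L$ be two bounded Borel sets in $\mathbb{R}^n$ with $|K|>0$. Let $f$ and $g$ be two bounded non-negative measurable functions on $K$ and $L$, respectively, and assume that $\|g\|_1>0$ and $\|g\|_\infty=1$. Then for every integer $1\le k\le n-1$, $$\frac{\int_K f}{\left(\int_L g\right)^{\frac{n-k}{n}}|K|^{\frac kn}}\le \left(C\cdot{\rm ovr}(K)\right)^k\sup_{H\in Gr_{n-k}}\frac{\int_{K\cap H}f}{\int_{L\cap H}g}.$$
   Context: $|\cdot|$ denotes volume (Lebesgue measure) of the appropriate dimension; integrals over $K\cap H$, $L\cap H$ are with respect to $(n-k)$-dimensional Lebesgue measure on $H$. $Gr_{n-k}$ is the Grassmannian of $(n-k)$-dimensional linear subspaces of $\mathbb{R}^n$. $\|g\|_1=\int_L g$ and $\|g\|_\infty$ is the sup-norm of $g$ on $L$. The outer volume ratio of a bounded Borel set $K\subset\mathbb{R}^n$ with $|K|>0$ is $${\rm ovr}(K)=\inf_{\mathcal{E}}\left(\frac{|\mathcal{E}|}{|K|}\right)^{1/n},$$ where the infimum is over all origin-symmetric ellipsoids $\mathcal{E}$ in $\mathbb{R}^n$ with $K\subseteq\mathcal{E}$. The supremum on the right-hand side takes values in $[0,+\infty]$, with the convention that a quotient $a/0$ is $+\infty$ if $a>0$ and is $0$ if $a=0$ (so the supremum is the least $M\in[0,\infty]$ with $\int_{K\cap H}f\le M\int_{L\cap H}g$ for all $H$). *)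

(* Defs.v *)
From HB Require Import structures.
From mathcomp Require Import all_boot all_order all_algebra.
From mathcomp Require Import all_classical all_reals all_analysis.
From mathcomp Require Import measurable_realfun.

Set Implicit Arguments.
Unset Strict Implicit.
Unset Printing Implicit Defensive.

Import Order.TTheory GRing.Theory Num.Theory.
Import numFieldNormedType.Exports.

Local Open Scope classical_set_scope.
Local Open Scope ring_scope.

(** R^n is ['rV[R]_n]. The library norm on it is the sup-norm, which has the same
    open sets (hence Borel sets) and the same bounded sets as the Euclidean norm. *)

Section borel_matrix.
Variables (R : realType) (m n : nat).

Definition borel_mx : set (set 'M[R]_(m, n)) := <<s open >>.

HB.instance Definition _ := @isMeasurable.Build
  (sigma_display (@open 'M[R]_(m, n))) 'M[R]_(m, n) borel_mx
  (@sigma_algebra0 _ _ _) (@sigma_algebraC _ _) (@sigma_algebra_bigcup _ _ _).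

Lemma open_measurable_mx (A : set 'M[R]_(m, n)) : open A -> measurable A.
Proof. by move=> oA; exact: sub_sigma_algebra. Qed.

Lemma measurable_mx_coord i j :
  measurable_fun [set: 'M[R]_(m, n)] (fun M : 'M[R]_(m, n) => M i j).
Proof.
apply: (measurability (@RGenOInfty.G R)); first exact: RGenOInfty.measurableE.
move=> _ [_ [a ->] <-]; rewrite setTI; apply: open_measurable_mx.
apply: open_comp; last exact: interval_open.
by move=> M _; exact: coord_continuous.
Qed.

Lemma measurable_fun_mxP d (T : measurableType d) (f : T -> 'M[R]_(m, n)) :
  measurable_fun setT f <->
  (forall i j, measurable_fun setT (fun x => f x i j)).
Proof.
split=> [mf i j|mf].
  exact: (measurableT_comp (measurable_mx_coord i j)).
apply: (measurability (@open 'M[R]_(m, n))) => // _ [U oU <-]; rewrite setTI.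
pose rbox (q : 'M[rat]_(m, n) * nat) : set 'M[R]_(m, n) :=
  [set M | forall i j, ball (ratr (q.1 i j) : R) q.2.+1%:R^-1 (M i j)].
pose F q := [set x | rbox q `<=` U /\ rbox q (f x)].
suff -> : f @^-1` U = \bigcup_q F q.
  apply: countable_bigcupT_measurable => // q.
  have [qU|nqU] := pselect (rbox q `<=` U); last first.
    by rewrite (_ : F q = set0)//; apply/seteqP; split=> // x [].
  rewrite (_ : F q = \bigcap_(ij in [set: 'I_m * 'I_n])
      ((fun x => f x ij.1 ij.2) @^-1` ball (ratr (q.1 ij.1 ij.2) : R) q.2.+1%:R^-1)).
    apply: fin_bigcap_measurable => // -[i j] _ /=.
    rewrite -[X in measurable X]setTI; apply: mf => //.
    by apply: (@open_measurable R); exact: ball_open.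
  apply/seteqP; split=> [x [_ fx] [i j] _|x fx]; first exact: fx.
  by split=> // i j; exact: (fx (i, j)).
apply/seteqP; split=> [x Ufx|x [q _ [qU]]]; last exact: qU.
have /nbhs_ballP[e /= e0 eU] : nbhs (f x) U by apply: open_nbhs_nbhs; split.
have [k ke] : exists k : nat, k.+1%:R^-1 < e / 2 :> R.
  exists (Num.truncn (e / 2)^-1).
  by rewrite invf_plt ?posrE ?divr_gt0// truncnS_gt.
have qP i j : exists q : rat, ball (f x i j) k.+1%:R^-1 (ratr q : R).
  have [|y [fy [q _ qy]]] := @dense_rat R _ _ (ball_open (f x i j) k.+1%:R^-1).
    by exists (f x i j); exact: ballxx.
  by exists q; rewrite qy.
exists (\matrix_(i, j) projT1 (cid (qP i j)), k) => //; split => [M qM|i j].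
  apply: eU; split=> // i j; have /= := qM i j; rewrite mxE.
  case: cid => q /= fq qMij; rewrite [e]splitr.
  by apply: ball_triangle; [exact: le_ball (ltW ke) _ fq|
                            exact: le_ball (ltW ke) _ qMij].
by rewrite /= mxE; apply: ball_sym; case: cid.
Qed.

End borel_matrix.

Lemma pushforward_sigma_finite d1 d2 (T1 : measurableType d1)
    (T2 : measurableType d2) (R : realType)
    (mu : set T1 -> \bar R) (f : T1 -> T2) (g : T2 -> T1) :
  measurable_fun setT g -> cancel f g ->
  sigma_finite setT mu -> sigma_finite setT (pushforward mu f).
Proof.
move=> mg fK [F FT Fmu].
exists (fun k => g @^-1` F k) => [|k].
  by rewrite -preimage_bigcup -FT.
have [mF muF] := Fmu k; split; first by rewrite -[X in measurable X]setTI; exact: mg.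
rewrite /pushforward -comp_preimage (_ : g \o f = id)//.
by apply/funext => x /=; rewrite fK.
Qed.

Lemma product_measure1_sigma_finite d1 d2 (T1 : measurableType d1)
    (T2 : measurableType d2) (R : realType)
    (m1 : {sigma_finite_measure set T1 -> \bar R})
    (m2 : {sigma_finite_measure set T2 -> \bar R}) :
  sigma_finite setT (m1 \x m2)%E.
Proof.
have /sigma_finiteP[F [TF ndF Foo]] := sigma_finiteT m1.
have /sigma_finiteP[G [TG ndG Goo]] := sigma_finiteT m2.
exists (fun n => F n `*` G n) => [|k].
  rewrite -setXTT TF TG; apply/seteqP; split=> [[x y]|[x y] [n _ []]].
    move=> [/= [n _ Fnx] [k _ Gky]]; exists (maxn n k) => //; split.
    - by move: x Fnx; exact/subsetPset/ndF/leq_maxl.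
    - by move: y Gky; exact/subsetPset/ndG/leq_maxr.
  by move=> Fx Gy; split; exists n.
have [? ?] := Foo k; have [? ?] := Goo k.
split; first exact: measurableX.
by rewrite product_measure1E// lte_mul_pinfty// ge0_fin_numE.
Qed.

Section lebesgue_rV.
Variable R : realType.

Definition cons_rV n (p : measurableTypeR R * 'rV[R]_n) : 'rV[R]_n.+1 :=
  row_mx (const_mx p.1 : 'rV_1) p.2.

Definition uncons_rV n (x : 'rV[R]_n.+1) : measurableTypeR R * 'rV[R]_n :=
  (x 0 0, rsubmx (x : 'rV_(1 + n))).

Lemma cons_rV0 n a (x : 'rV[R]_n) : cons_rV (a, x) 0 ord0 = a.
Proof. by rewrite mxE; case: splitP => // j _; rewrite mxE. Qed.

Lemma cons_rVS n a (x : 'rV[R]_n) i : cons_rV (a, x) 0 (lift ord0 i) = x 0 i.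
Proof.
rewrite mxE; case: splitP => [[[]]//|j /= ij].
by congr (x 0 _); apply: val_inj; move: ij; rewrite /bump leq0n => -[].
Qed.

Lemma cons_rVK n : cancel (@cons_rV n) (@uncons_rV n).
Proof.
move=> [a x]; rewrite /uncons_rV /cons_rV row_mxKr; congr pair.
exact: cons_rV0.
Qed.

Lemma measurable_cons_rV n : measurable_fun setT (@cons_rV n).
Proof.
apply/measurable_fun_mxP => i j; rewrite /cons_rV.
under eq_fun do rewrite mxE.
case: splitP => k _.
  by under eq_fun do rewrite mxE; exact: measurable_fst.
exact: (measurableT_comp (measurable_mx_coord i k)).
Qed.

Lemma measurable_uncons_rV n : measurable_fun setT (@uncons_rV n).
Proof.
apply/measurable_fun_pair; first exact: (measurable_mx_coord 0 0).
apply/measurable_fun_mxP => i j; under eq_fun do rewrite mxE.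
exact: measurable_mx_coord.
Qed.

Section step.
Variables (n : nat) (mu : {sigma_finite_measure set 'rV[R]_n -> \bar R}).

Definition lebesgue_rV_step : set 'rV[R]_n.+1 -> \bar R :=
  pushforward (@lebesgue_measure R \x mu)%E (@cons_rV n).

Let step0 : lebesgue_rV_step set0 = 0%E.
Proof. by rewrite /lebesgue_rV_step /pushforward preimage_set0 measure0. Qed.

Let step_ge0 A : (0 <= lebesgue_rV_step A)%E.
Proof. by rewrite /lebesgue_rV_step /pushforward; exact: measure_ge0. Qed.

Let step_sigma_additive : semi_sigma_additive lebesgue_rV_step.
Proof.
by apply: measure_semi_sigma_additive; exact: measurable_cons_rV.
Qed.

HB.instance Definition _ := isMeasure.Build _ _ _ lebesgue_rV_step
  step0 step_ge0 step_sigma_additive.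

Let step_sigma_finite : sigma_finite setT lebesgue_rV_step.
Proof.
apply: (pushforward_sigma_finite (@measurable_uncons_rV n) (@cons_rVK n)).
exact: product_measure1_sigma_finite.
Qed.

HB.instance Definition _ := Measure_isSigmaFinite.Build _ _ _ lebesgue_rV_step
  step_sigma_finite.

End step.

(** n-dimensional Lebesgue measure as an iterated product of the one-dimensional
    one; [lebesgue_rV_box] below is its defining property. *)
Fixpoint lebesgue_rV n : {sigma_finite_measure set 'rV[R]_n -> \bar R} :=
  match n with
  | 0%N => dirac (0 : 'rV[R]_0)
  | n'.+1 => lebesgue_rV_step (lebesgue_rV n')
  end.

Lemma lebesgue_rV_box n (A : 'I_n -> set R) : (forall i, measurable (A i)) ->
  lebesgue_rV n [set x | forall i, A i (x 0 i)] =
  (\prod_(i < n) lebesgue_measure (A i))%E.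
Proof.
elim: n A => [|n IHn] A mA /=.
  by rewrite big_ord0 diracE mem_set// => -[].
have mB : measurable [set x : 'rV[R]_n | forall i, A (lift ord0 i) (x 0 i)].
  rewrite (_ : [set x | _] =
    \bigcap_(i in [set: 'I_n]) (fun x : 'rV_n => x 0 i) @^-1` A (lift ord0 i)).
    apply: fin_bigcap_measurable => // i _.
    by rewrite -[X in measurable X]setTI; exact: measurable_mx_coord.
  by apply/seteqP; split=> [x Ax i _|x Ax i]; exact: Ax.
rewrite big_ord_recl -IHn => [|i]; last exact: mA.
have <- := @product_measure1E _ _ (measurableTypeR R) _ _ lebesgue_measure
  (lebesgue_rV n) _ _ (mA ord0) mB.
rewrite /lebesgue_rV_step /pushforward; congr (product_measure1 _ _ _).
apply/seteqP; split=> [[a x] /= Aax|[a x] [/= Aa Ax] i].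
  split=> [|i] /=; first by have := Aax ord0; rewrite cons_rV0.
  by have := Aax (lift ord0 i); rewrite cons_rVS.
by case: (unliftP ord0 i) => [j|] ->; rewrite ?cons_rV0 ?cons_rVS.
Qed.

End lebesgue_rV.

Section subspaces.
Variables (R : realType) (n : nat).

Definition Gr m : set {vspace 'rV[R]_n} := [set H | \dim H = m].

Definition orthonormal_basis m (B : 'M[R]_(m, n)) (H : {vspace 'rV[R]_n}) :=
  B *m B^T = 1%:M /\ forall x, x \in H <-> exists y : 'rV_m, x = y *m B.

Lemma orthonormal_basis_exists m (H : {vspace 'rV[R]_n}) :
  \dim H = m -> exists B : 'M[R]_(m, n), orthonormal_basis B H.
Proof.
elim: m H => [|m IHm] H dimH.
  exists 0; split=> [|x]; first by rewrite !flatmx0.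
  move/eqP: dimH; rewrite dimv_eq0 => /eqP ->; rewrite memv0.
  by split=> [/eqP ->|[y ->]]; [exists 0|]; rewrite mulmx0.
have H0 : H != 0%VS by rewrite -dimv_eq0 dimH.
pose u := vpick H; have u0 : u != 0 by rewrite vpick0.
have uu0 : 0 < (u *m u^T) 0 0.
  have /rV0Pn[i ui] := u0.
  rewrite mxE (bigD1 i)//= mxE -expr2 ltr_wpDr//.
    by apply: sumr_ge0 => j _; rewrite mxE -expr2 sqr_ge0.
  by rewrite lt_neqAle sqr_ge0 eq_sym sqrf_eq0 ui.
pose e := (Num.sqrt ((u *m u^T) 0 0))^-1 *: u.
have eH : e \in H by rewrite memvZ// memv_pick.
have ee : e *m e^T = 1%:M.
  rewrite /e linearZ/= -scalemxAl -scalemxAr scalerA -invfM -expr2.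
  rewrite sqr_sqrtr ?ltW// [u *m u^T]mx11_scalar mxE eqxx mulr1n.
  by rewrite scale_scalar_mx mulVf// gt_eqF.
pose f : 'Hom('rV[R]_n, 'rV[R]_1) := linfun (mulmxr e^T).
have fE x : f x = x *m e^T by rewrite lfunE.
have dimK : \dim (H :&: lker f) = m.
  suff fH : \dim (f @: H) = 1%N.
    by have := limg_ker_dim f H; rewrite dimH fH addn1 => -[].
  apply/eqP; rewrite eqn_leq; apply/andP; split.
    by rewrite (leq_trans (dimvS (subvf _)))// dimvf /dim/= mul1n.
  rewrite lt0n dimv_eq0; apply/eqP => fH0.
  have : f e \in (f @: H)%VS by exact: memv_img.
  by rewrite fH0 memv0 fE ee oner_eq0.
have [B [BB BH]] := IHm _ dimK.
have Be i : row i B *m e^T = 0.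
  have /memv_capP[_] : row i B \in (H :&: lker f)%VS.
    by apply/BH; exists (delta_mx 0 i); rewrite -rowE.
  by rewrite memv_ker fE => /eqP.
have Be0 : B *m e^T = 0.
  by apply/row_matrixP => i; rewrite row_mul Be row0.
have eBeB : col_mx e B *m (col_mx e B)^T = 1%:M.
  rewrite tr_col_mx mul_col_row ee BB Be0 -[e *m B^T]trmxK trmx_mul trmxK Be0.
  by rewrite trmx0 -scalar_mx_block.
exists (col_mx e B); split=> // x.
split=> [xH|[y ->]].
  have : x - x *m e^T *m e \in (H :&: lker f)%VS.
    rewrite memv_cap memv_ker fE; apply/andP; split.
      by rewrite memvB// [x *m _]mx11_scalar mul_scalar_mx memvZ.
    by rewrite mulmxBl -(mulmxA _ e) ee mulmx1 subrr.
  move/BH => [y xy]; exists (row_mx (x *m e^T) y : 'rV_(1 + m)).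
  by rewrite [RHS](@mul_row_col _ _ 1 m) -xy addrC subrK.
rewrite -[y](@hsubmxK _ _ 1 m) (@mul_row_col _ _ 1 m) memvD//.
  by rewrite [lsubmx (y : 'rV_(1 + m))]mx11_scalar mul_scalar_mx memvZ.
have /memv_capP[]// : rsubmx (y : 'rV_(1 + m)) *m B \in (H :&: lker f)%VS.
by apply/BH; eexists.
Qed.

(** An orthonormal basis of [H], as the rows of a matrix. *)
Definition onframe (H : {vspace 'rV[R]_n}) : 'M[R]_(\dim H, n) :=
  projT1 (cid (orthonormal_basis_exists (erefl (\dim H)))).

Lemma onframeP H : orthonormal_basis (onframe H) H.
Proof. by rewrite /onframe; case: cid. Qed.

Lemma measurable_mulmxr m (B : 'M[R]_(m, n)) :
  measurable_fun setT (fun y : 'rV[R]_m => y *m B).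
Proof.
apply/measurable_fun_mxP => i j; under eq_fun do rewrite mxE.
apply: measurable_sum => k; apply: measurable_funM => //.
exact: measurable_mx_coord.
Qed.

(** Lebesgue measure of dimension [\dim H] on the Euclidean space [H], seen as a
    measure on R^n carried by [H]: the image of Lebesgue measure on R^(\dim H)
    under the linear isometry onto [H] given by an orthonormal basis. Lebesgue
    measure being rotation invariant, the choice of the basis is immaterial. *)
Definition lebesgue_vspace (H : {vspace 'rV[R]_n}) : set 'rV[R]_n -> \bar R :=
  pushforward (lebesgue_rV R (\dim H)) (fun y => y *m onframe H).

Section lebesgue_vspace_measure.
Variable H : {vspace 'rV[R]_n}.

Let mu0 : lebesgue_vspace H set0 = 0%E.
Proof. by rewrite /lebesgue_vspace /pushforward preimage_set0 measure0. Qed.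

Let mu_ge0 A : (0 <= lebesgue_vspace H A)%E.
Proof. by rewrite /lebesgue_vspace /pushforward; exact: measure_ge0. Qed.

Let mu_sigma_additive : semi_sigma_additive (lebesgue_vspace H).
Proof.
by apply: measure_semi_sigma_additive; exact: measurable_mulmxr.
Qed.

HB.instance Definition _ := isMeasure.Build _ _ _ (lebesgue_vspace H)
  mu0 mu_ge0 mu_sigma_additive.

End lebesgue_vspace_measure.

Definition euclidean_ball : set 'rV[R]_n := [set x | \sum_i x 0 i ^+ 2 <= 1].

(** Images of the unit ball under invertible linear maps. *)
Definition sym_ellipsoid : set (set 'rV[R]_n) :=
  [set [set x *m A | x in euclidean_ball] | A in [set` unitmx]].

(** Extended-real infimum; only meant for bounded Borel [K] of positive measure. *)
Definition ovr (K : set 'rV[R]_n) : \bar R :=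
  ereal_inf [set ((lebesgue_rV R n E / lebesgue_rV R n K) `^ n%:R^-1)%E
            | E in [set E | sym_ellipsoid E /\ K `<=` E]].

End subspaces.

(* Main.v *)
From HB Require Import structures.
Require Import Defs.
From mathcomp Require Import all_boot all_order all_algebra.
From mathcomp Require Import all_classical all_reals all_analysis.
From mathcomp Require Import measurable_realfun.
From mathcomp Require Import ring lra.

Set Implicit Arguments.
Unset Strict Implicit.
Unset Printing Implicit Defensive.

Import Order.TTheory GRing.Theory Num.Theory.
Import numFieldNormedType.Exports.

Local Open Scope classical_set_scope.
Local Open Scope ring_scope.

(** Let m = n - k and let G be an m x n matrix with independent standard Gaussian entries.
    For each y in R^m, the vector y G is |y| times a standard Gaussian vector of R^n, so that,
    with a constant w > 0,
      E (int_(R^m) F(y G) dy) = w int_(R^n) F(x) |x|^(-k) dx   for all F >= 0.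
    Almost surely G has full rank, and then the inner integral is the integral of F over the
    row space H of G, up to a factor that depends only on G. If int_(K /\ H) f <= M int_(L /\ H) g
    for all H, averaging therefore gives
      int_K f(x) |x|^(-k) dx <= M int_L g(x) |x|^(-k) dx.
    The hypothesis is invariant under invertible linear maps, so one may assume that the
    ellipsoid containing K is the unit ball. The left-hand side is then at least int_K f. Since
    0 <= g <= 1, cutting at the radius r of the ball of volume int_L g bounds the right-hand
    integral by (2^(k+1) + 1) r^(n-k) |B| <= 5^k (int_L g)^((n-k)/n) |B|^(k/n). It remains to
    take the infimum over the ellipsoids; C = 5 works. *)

(** * Translations *)

Section lebesgue_translation.
Variable R : realType.
Implicit Types n : nat.

(** Gaussian matrices stand in for the invariant measure on the Grassmannian: for fixed [y] the
    vector [y G] has an explicit law, so the average is computed by Tonelli and one change of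
    variables. The weight [|x|^(-k)] arises because, for fixed [x], the density of [|y| Z] at [x],
    integrated over [y] in [R^m], is a function of [|x|] homogeneous of degree [m - n = -k]. The
    factor [w] is common to both sides, so only its positivity and finiteness matter; the factors of
    linear changes of variables cancel in the same way. The hypothesis is used as an inequality for
    all full-rank [G]. Since [G A] has full rank with [G], its linear invariance is immediate,
    whereas on subspaces [A] distorts the measure of each [H] by its own factor. Radial integrals
    are compared with sums over balls of dyadic radii. This costs a factor [2^(k+1)], which [C^k]
    absorbs: [2^(k+1) + 1 <= 5^k], with equality at [k = 1]. The supremum may be 0 and the infimum
    over ellipsoids need not be attained, so the end of the proof works with a slack [e] and with
    lower bounds. *)

Lemma lebesgue_measure_shift (c : R) (f : measurableTypeR R -> \bar R) :
  measurable_fun setT f -> (forall x, 0 <= f x)%E ->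
  (\int[lebesgue_measure]_x f (x + c)%R = \int[lebesgue_measure]_x f x)%E.
Proof.
move=> mf f0.
pose sh (x : measurableTypeR R) : measurableTypeR R := x + c.
have msh : measurable_fun setT sh by exact: measurable_funD.
pose shM : {mfun measurableTypeR R >-> measurableTypeR R} :=
  HB.pack sh (isMeasurableFun.Build _ _ _ _ _ msh).
(* Both measures give every half-open interval its length, which determines them. *)
have muE A : measurable A -> lebesgue_measure A = pushforward lebesgue_measure shM A.
  move=> mA; apply: (lebesgue_measure_unique (mu := pushforward lebesgue_measure shM)) => //.
  move=> _ [[a b] /= _ <-].
  rewrite /pushforward (_ : shM @^-1` `]a, b] = `]a - c, b - c]%classic).
    rewrite !lebesgue_measure_itv/= !lte_fin ltrD2r.
    by case: ifP => // _; rewrite -!EFinB; congr EFin; ring.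
  by apply/seteqP; split=> x /=; rewrite !in_itv/= /sh lerBrDr ltrBlDr.
rewrite [RHS](eq_measure_integral (pushforward lebesgue_measure shM))//; last first.
  by move=> A mA _; exact: muE.
rewrite [RHS](@ge0_integral_pushforward _ _ _ _ R sh msh lebesgue_measure setT)//.
Qed.

Lemma sigma_finite_fubini d1 d2 (T1 : measurableType d1) (T2 : measurableType d2)
    (m1 : {sigma_finite_measure set T1 -> \bar R})
    (m2 : {sigma_finite_measure set T2 -> \bar R}) (F : T1 -> T2 -> \bar R) :
  measurable_fun setT (fun p : T1 * T2 => F p.1 p.2) ->
  (forall x y, 0 <= F x y)%E ->
  (\int[m1]_x \int[m2]_y F x y = \int[m2]_y \int[m1]_x F x y)%E.
Proof.
by move=> mF F0; apply: (fubini_tonelli (fun p => F p.1 p.2)).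
Qed.

Lemma integral_cons_rV n (f : 'rV[R]_n.+1 -> \bar R) :
  measurable_fun setT f -> (forall x, 0 <= f x)%E ->
  (\int[lebesgue_rV R n.+1]_x f x =
   \int[lebesgue_measure]_a \int[lebesgue_rV R n]_x f (cons_rV (a, x)))%E.
Proof.
move=> mf f0.
rewrite /= /lebesgue_rV_step.
rewrite (@ge0_integral_pushforward _ _ _ _ R _ (@measurable_cons_rV R n) _ setT)//.
rewrite preimage_setT fubini_tonelli1//.
- by apply: measurableT_comp => //; exact: measurable_cons_rV.
- by move=> x; exact: f0.
Qed.

Lemma measurable_cons_rV_pair n (f : 'rV[R]_n.+1 -> \bar R) : measurable_fun setT f ->
  measurable_fun setT (fun p : measurableTypeR R * 'rV[R]_n => f (cons_rV p)).
Proof. by move=> mf; apply: measurableT_comp => //; exact: measurable_cons_rV. Qed.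

Lemma measurable_addmx m n d (T : measurableType d) (f g : T -> 'M[R]_(m, n)) :
  measurable_fun setT f -> measurable_fun setT g ->
  measurable_fun setT (fun x => f x + g x).
Proof.
move=> /measurable_fun_mxP mf /measurable_fun_mxP mg; apply/measurable_fun_mxP => i j.
by under eq_fun do rewrite mxE; exact: measurable_funD.
Qed.

Lemma measurable_scalemx m n d (T : measurableType d) (a : T -> R) (g : T -> 'M[R]_(m, n)) :
  measurable_fun setT a -> measurable_fun setT g ->
  measurable_fun setT (fun x => a x *: g x).
Proof.
move=> ma /measurable_fun_mxP mg; apply/measurable_fun_mxP => i j.
by under eq_fun do rewrite mxE; exact: measurable_funM.
Qed.

Lemma measurable_mulmx m n p d (T : measurableType d) (f : T -> 'M[R]_(m, n))
    (g : T -> 'M[R]_(n, p)) :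
  measurable_fun setT f -> measurable_fun setT g ->
  measurable_fun setT (fun x => f x *m g x).
Proof.
move=> /measurable_fun_mxP mf /measurable_fun_mxP mg; apply/measurable_fun_mxP => i j.
under eq_fun do rewrite mxE.
by apply: measurable_sum => k; exact: measurable_funM.
Qed.

Lemma cons_rVD n a b (x y : 'rV[R]_n) :
  cons_rV (a, x) + cons_rV (b, y) = cons_rV ((a + b)%R : measurableTypeR R, x + y).
Proof.
apply/rowP => i; rewrite mxE.
by case: (unliftP ord0 i) => [j|] ->; rewrite ?cons_rV0 ?cons_rVS ?mxE.
Qed.

Lemma uncons_rVK n : cancel (@uncons_rV R n) (@cons_rV R n).
Proof.
move=> x; apply/rowP => i.
case: (unliftP ord0 i) => [j|] ->; rewrite ?cons_rV0 ?cons_rVS ?mxE.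
  by congr (x _ _); apply/val_inj.
by [].
Qed.

Lemma cons_rVP n (P : 'rV[R]_n.+1 -> Prop) :
  (forall a x, P (cons_rV (a, x))) -> forall x, P x.
Proof. by move=> H x; rewrite -[x]uncons_rVK; case: uncons_rV. Qed.

(** Induction on the dimension: Tonelli peels off the first coordinate, the inner integral absorbs
    the tail of [v] and the outer one its head. *)
Lemma lebesgue_rV_shift n (v : 'rV[R]_n) (f : 'rV[R]_n -> \bar R) :
  measurable_fun setT f -> (forall x, 0 <= f x)%E ->
  (\int[lebesgue_rV R n]_x f (x + v)%R = \int[lebesgue_rV R n]_x f x)%E.
Proof.
elim: n v f => [|n IH] v f mf f0.
  by apply: eq_integral => x _; congr f; rewrite [LHS]thinmx0 [RHS]thinmx0.
move: v; apply: cons_rVP => b v.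
have mfv : measurable_fun setT (fun x : 'rV[R]_n.+1 => f (x + cons_rV (b, v))).
  by apply: measurableT_comp => //; apply: measurable_addmx.
rewrite !integral_cons_rV//.
under eq_integral => a _.
  under eq_integral do rewrite cons_rVD.
  rewrite (IH v (fun x => f (cons_rV (((a + b)%R : measurableTypeR R), x))))//; last first.
    apply: (measurableT_comp (measurable_cons_rV_pair mf)).
    by apply/measurable_fun_pair.
  over.
rewrite (lebesgue_measure_shift b (f := fun a => \int[lebesgue_rV R n]_x f (cons_rV (a, x)))%E)//.
  exact: (measurable_fun_fubini_tonelli_F (fun p => f (cons_rV p)) (measurable_cons_rV_pair mf)).
by move=> a; apply: integral_ge0.
Qed.

End lebesgue_translation.

(** * Linear changes of variables *)

Section lebesgue_linear.
Variable R : realType.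
Implicit Types n : nat.

(** Cubes have an explicit measure by the product construction. The normalisation of [psi], the
    bounds on the volume of the ball and the nullity of the origin are all read off them. *)
Definition cube n (r : R) : set 'rV[R]_n := [set x | forall i, x 0 i \in `[- r, r]].

Lemma cube_box n (r : R) :
  cube r = [set x : 'rV[R]_n | forall i, (fun=> `[- r, r]%classic) i (x 0 i)].
Proof. by apply/seteqP; split=> x /= Hx i; have := Hx i. Qed.

Lemma measurable_cube n (r : R) : measurable (@cube n r).
Proof.
rewrite (_ : @cube n r =
  \bigcap_(i in [set: 'I_n]) (fun x : 'rV_n => x 0 i) @^-1` `[- r, r]%classic).
  apply: fin_bigcap_measurable => // i _.
  by rewrite -[X in measurable X]setTI; exact: measurable_mx_coord.
by apply/seteqP; split=> [x Ax i _|x Ax i]; have := Ax i; [|exact].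
Qed.

Lemma lebesgue_cube n (r : R) : 0 <= r -> lebesgue_rV R n (cube r) = ((2 * r) ^+ n)%:E.
Proof.
move=> r0; rewrite cube_box (@lebesgue_rV_box R n (fun=> `[- r, r]%classic))//.
rewrite (eq_bigr (fun=> (2 * r)%:E)).
  by rewrite prodEFin prodr_const card_ord.
move=> i _; rewrite lebesgue_measure_itv/= lte_fin.
case: ltP => h; first by rewrite -EFinB; congr EFin; ring.
by have -> : r = 0 by [lra]; rewrite mulr0.
Qed.

(** Test function of the uniqueness argument, chosen even and of known positive finite integral. *)
Let psi n (x : 'rV[R]_n) : \bar R := (\1_(cube (1:R)) x)%:E.

Let psi_ge0 n (x : 'rV[R]_n) : (0 <= psi x)%E.
Proof. by rewrite /psi lee_fin. Qed.

Let measurable_psi n : measurable_fun setT (@psi n).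
Proof. by apply/measurable_EFinP; apply: measurable_indic; exact: measurable_cube. Qed.

Let psiN n (x : 'rV[R]_n) : psi (- x) = psi x.
Proof.
rewrite /psi !indicE; suff -> : (- x \in cube (1 : R)) = (x \in cube (1 : R)) by [].
by apply/idP/idP; rewrite !inE => H i; have := H i; rewrite ?mxE !in_itv/= => /andP[? ?];
  apply/andP; split; lra.
Qed.

Let integral_psi n : (\int[lebesgue_rV R n]_x psi x = (2 ^+ n)%:E)%E.
Proof.
rewrite integral_indic//; last exact: measurable_cube.
by rewrite setIT; apply: etrans (lebesgue_cube n ler01) _; rewrite mulr1.
Qed.

(* Uniqueness of Haar measure: both sides compute
   the integral of psi (y A) phi (x + y A) over all (x, y). *)
Let haar n (A : 'M[R]_n) (phi : 'rV[R]_n -> \bar R) : A \in unitmx ->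
  measurable_fun setT phi -> (forall x, 0 <= phi x)%E ->
  ((\int[lebesgue_rV R n]_y psi (y *m A)) * (\int[lebesgue_rV R n]_x phi x) =
   (\int[lebesgue_rV R n]_y phi (y *m A)) * (2 ^+ n)%:E)%E.
Proof.
move=> uA mphi phi0.
have mA : measurable_fun setT (fun y : 'rV[R]_n => y *m A) by exact: measurable_mulmxr.
have mphiA : measurable_fun setT (fun y : 'rV[R]_n => phi (y *m A)).
  exact: measurableT_comp.
have mpsiA : measurable_fun setT (fun y : 'rV[R]_n => psi (y *m A)).
  exact: measurableT_comp.
have mA1 : measurable_fun setT (fun p : 'rV[R]_n * 'rV[R]_n => p.1 *m A).
  by apply: (measurableT_comp mA).
have mA2 : measurable_fun setT (fun p : 'rV[R]_n * 'rV[R]_n => p.2 *m A).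
  by apply: (measurableT_comp mA).
rewrite muleC -ge0_integralZl//; last exact: integral_ge0.
under eq_integral => y _.
  rewrite muleC -ge0_integralZl// -(lebesgue_rV_shift (y *m A)); last 2 first.
  - by apply: emeasurable_funM.
  - by move=> x; apply: mule_ge0.
  over.
rewrite sigma_finite_fubini/=; last 2 first.
- apply: emeasurable_funM; first exact: (measurableT_comp (@measurable_psi n)).
  by apply: measurableT_comp => //; apply: measurable_addmx.
- by move=> x y; apply: mule_ge0.
transitivity (\int[lebesgue_rV R n]_x \int[lebesgue_rV R n]_y
    (psi (x - y *m A)%R * phi (y *m A)))%E.
  apply: eq_integral => x _.
  (* Replacing [y] by [y - x A^-1] turns [x + y A] into [y A], and [y A] into [y A - x]. As [psi] is
     even, this leaves [psi (x - y A)], whose integral in [x] does not depend on [y]. *)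
  rewrite -[LHS](lebesgue_rV_shift (- (x *m invmx A))); last 2 first.
  - apply: emeasurable_funM => //.
    by apply: measurableT_comp => //; apply: measurable_addmx.
  - by move=> y; apply: mule_ge0.
  apply: eq_integral => y _.
  by rewrite mulmxDl mulNmx mulmxKV// (addrC (y *m A)) addNKr -psiN opprD opprK.
rewrite sigma_finite_fubini/=; last 2 first.
- apply: emeasurable_funM.
    apply: (measurableT_comp (@measurable_psi n)); apply: measurable_addmx => //.
    rewrite (_ : (fun _ => _) = fun p : 'rV[R]_n * 'rV[R]_n => p.2 *m - A); last first.
      by apply/funext => p; rewrite mulmxN.
    apply: measurable_mulmx => //.
  by apply: (measurableT_comp mphi).
- by move=> x y; apply: mule_ge0.
rewrite muleC -ge0_integralZl//.
apply: eq_integral => y _.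
under eq_integral do rewrite muleC.
rewrite ge0_integralZl//.
  by rewrite lebesgue_rV_shift// integral_psi muleC.
by apply: measurableT_comp => //; apply: measurable_addmx.
Qed.

(** The factor is [J A / 2 ^+ n], where [J B] is the integral of [psi (y B)]. Uniqueness applied to
    [psi (y A^-1)] gives [J A * J (A^-1) = 4 ^+ n], which forces [J A] to be positive and finite.
    Where an explicit value matters, as in [lebesgue_rV_scale] and [gauss_rV_even], it is read off a
    test function of known integral. *)
Lemma lebesgue_rV_linear n (A : 'M[R]_n) : A \in unitmx ->
  exists2 c : R, 0 < c & forall phi, measurable_fun setT phi -> (forall x, 0 <= phi x)%E ->
    (\int[lebesgue_rV R n]_x phi (x *m A) = c%:E * \int[lebesgue_rV R n]_x phi x)%E.
Proof.
move=> uA.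
have c2n : (0 : R) < 2 ^+ n by rewrite exprn_gt0.
pose J (B : 'M[R]_n) : \bar R := (\int[lebesgue_rV R n]_y psi (y *m B))%E.
have J0 B : (0 <= J B)%E by exact: integral_ge0.
have JJ : (J A * J (invmx A) = (2 ^+ n * 2 ^+ n)%:E)%E.
  rewrite (@haar n A (fun y => psi (y *m invmx A)))//; last first.
    by apply: measurableT_comp => //; exact: measurable_mulmxr.
  under eq_integral do rewrite mulmxK//.
  by rewrite integral_psi.
have [a a0 Ja] : exists2 a, 0 < a & J A = a%:E.
  have JA_neq0 : J A != 0%E.
    by apply/negP => /eqP JA0; move: JJ => /eqP; rewrite JA0 mul0e eq_sym eqe gt_eqF// mulr_gt0.
  have JV_neq0 : J (invmx A) != 0%E.
    by apply/negP => /eqP JA0; move: JJ => /eqP; rewrite JA0 mule0 eq_sym eqe gt_eqF// mulr_gt0.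
  have JA_gt0 : (0 < J A)%E by rewrite lt_neqAle eq_sym JA_neq0 J0.
  have JV_gt0 : (0 < J (invmx A))%E by rewrite lt_neqAle eq_sym JV_neq0 J0.
  move: JJ JA_gt0; case: (J A) => [a _|JJ _|//]; first by rewrite lte_fin; exists a.
  by move: JJ; rewrite gt0_mulye.
exists (a / 2 ^+ n) => [|phi mphi phi0]; first by rewrite divr_gt0.
have := haar uA mphi phi0; rewrite -/(J A) Ja => H.
rewrite mulrC EFinM -muleA H muleCA -EFinM mulVf ?mule1// gt_eqF//.
Qed.

Lemma cube_scale n (s r : R) (x : 'rV[R]_n) : 0 < s ->
  cube r (s *: x) = cube (r / s) x.
Proof.
move=> s0; apply/propext; split=> H i; have := H i; rewrite !in_itv/= ?mxE.
  by rewrite ler_pdivlMr// -mulNr ler_pdivrMr// ![x 0 i * s]mulrC.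
by rewrite ler_pdivlMr// -mulNr ler_pdivrMr// ![x 0 i * s]mulrC.
Qed.

(** A scalar matrix is invertible, so some factor exists; comparing the cube of side 2 with its
    preimage of side [2 / s] identifies it. *)
Lemma lebesgue_rV_scale n (s : R) (phi : 'rV[R]_n -> \bar R) : 0 < s ->
  measurable_fun setT phi -> (forall x, 0 <= phi x)%E ->
  (\int[lebesgue_rV R n]_x phi (s *: x)%R =
    ((s ^+ n)^-1)%:E * \int[lebesgue_rV R n]_x phi x)%E.
Proof.
move=> s0 mphi phi0.
have us : s%:M \in @unitmx R n by rewrite unitmxE det_scalar unitfE expf_neq0// gt_eqF.
have [c c0 Hc] := lebesgue_rV_linear us.
suff <- : c = (s ^+ n)^-1.
  by rewrite -Hc//; apply: eq_integral => x _; rewrite mul_mx_scalar.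
have := Hc (@psi n) (@measurable_psi n) (@psi_ge0 n).
rewrite integral_psi.
under eq_integral do rewrite mul_mx_scalar.
rewrite (_ : (fun _ => _) = fun x => (\1_(cube s^-1) x)%:E).
  have s10 : 0 <= s^-1 by rewrite invr_ge0 ltW.
  rewrite integral_indic//; last exact: measurable_cube.
  rewrite setIT => H; have := etrans (esym (lebesgue_cube n s10)) H.
  rewrite -EFinM => -[].
  rewrite exprMn mulrC exprVn => /mulIf -> //.
apply/funext => x; rewrite /psi !indicE.
suff -> : (s *: x \in cube (1 : R)) = (x \in cube s^-1) by [].
by apply/idP/idP; rewrite !inE cube_scale// mul1r.
Qed.

End lebesgue_linear.

(** * Gaussian densities and their stability *)

Section gaussian.
Variable R : realType.
Implicit Types n : nat.

Definition sqn n (x : 'rV[R]_n) : R := \sum_i x 0 i ^+ 2.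

Definition enorm n (x : 'rV[R]_n) : R := Num.sqrt (sqn x).

Lemma sqn_ge0 n (x : 'rV[R]_n) : 0 <= sqn x.
Proof. by apply: sumr_ge0 => i _; exact: sqr_ge0. Qed.

Lemma sqn_eq0 n (x : 'rV[R]_n) : (sqn x == 0) = (x == 0).
Proof.
apply/idP/eqP => [|->]; last by rewrite /sqn big1// => i _; rewrite mxE expr0n.
rewrite psumr_eq0 => [/allP H|i _]; last exact: sqr_ge0.
apply/rowP => i; rewrite mxE; apply/eqP; rewrite -sqrf_eq0.
by apply: H; rewrite mem_index_enum.
Qed.

Lemma sqn_cons_rV n a (x : 'rV[R]_n) : sqn (cons_rV (a, x)) = a ^+ 2 + sqn x.
Proof.
rewrite /sqn big_ord_recl cons_rV0; congr (_ + _).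
by apply: eq_bigr => i _; rewrite cons_rVS.
Qed.

Lemma sqnZ n (c : R) (x : 'rV[R]_n) : sqn (c *: x) = c ^+ 2 * sqn x.
Proof. by rewrite /sqn mulr_sumr; apply: eq_bigr => i _; rewrite mxE exprMn. Qed.

Lemma sqnN n (x : 'rV[R]_n) : sqn (- x) = sqn x.
Proof. by rewrite -scaleN1r sqnZ sqrrN expr1n mul1r. Qed.

Lemma enorm_ge0 n (x : 'rV[R]_n) : 0 <= enorm x.
Proof. exact: sqrtr_ge0. Qed.

Lemma enorm_sqr n (x : 'rV[R]_n) : enorm x ^+ 2 = sqn x.
Proof. by rewrite sqr_sqrtr// sqn_ge0. Qed.

Lemma enorm_eq0 n (x : 'rV[R]_n) : (enorm x == 0) = (x == 0).
Proof. by rewrite -sqrf_eq0 enorm_sqr sqn_eq0. Qed.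

Lemma enorm_gt0 n (x : 'rV[R]_n) : (0 < enorm x) = (x != 0).
Proof. by rewrite lt_neqAle enorm_ge0 andbT eq_sym enorm_eq0. Qed.

Lemma enormZ n (c : R) (x : 'rV[R]_n) : enorm (c *: x) = `|c| * enorm x.
Proof. by rewrite /enorm sqnZ sqrtrM ?sqr_ge0// sqrtr_sqr. Qed.

Lemma measurable_sqn n : measurable_fun setT (@sqn n).
Proof.
apply: measurable_sum => i; apply: measurable_funX.
exact: (measurable_mx_coord 0 i).
Qed.

Lemma measurable_enorm n : measurable_fun setT (@enorm n).
Proof.
apply: (measurableT_comp (f := @Num.sqrt R)); last exact: measurable_sqn.
by apply: continuous_measurable_fun; exact: sqrt_continuous.
Qed.

(** Each coordinate has variance 1/2: without the usual 1/2 in the exponent the normalisation is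
    [pi] to the power [- n / 2], in agreement with [gauss_fun]. *)
Definition gauss_rV n (x : 'rV[R]_n) : R := (Num.sqrt pi) ^- n * expR (- sqn x).

Lemma gauss_rV_gt0 n (x : 'rV[R]_n) : 0 < gauss_rV x.
Proof. by rewrite mulr_gt0 ?expR_gt0// invr_gt0 exprn_gt0// sqrtr_gt0 pi_gt0. Qed.

Lemma gauss_rV_ge0 n (x : 'rV[R]_n) : 0 <= gauss_rV x.
Proof. exact/ltW/gauss_rV_gt0. Qed.

Lemma measurable_gauss_rV n : measurable_fun setT (@gauss_rV n).
Proof.
apply: measurable_funM => //; apply: measurableT_comp => //.
by apply: measurableT_comp => //; exact: measurable_sqn.
Qed.

Lemma measurable_gauss_rVE n : measurable_fun setT (fun x : 'rV[R]_n => (gauss_rV x)%:E).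
Proof. exact: (iffRL (measurable_EFinP _ _) (@measurable_gauss_rV n)). Qed.

Lemma integral_gauss_rV n : (\int[lebesgue_rV R n]_x (gauss_rV x)%:E = 1)%E.
Proof.
elim: n => [|n IH].
  rewrite integral_dirac//; last exact: measurable_gauss_rVE.
  by rewrite diracT mul1e /gauss_rV /sqn big_ord0 oppr0 expR0 expr0 invr1 mulr1.
rewrite integral_cons_rV; last 2 first.
- exact: measurable_gauss_rVE.
- by move=> x; rewrite lee_fin gauss_rV_ge0.
have pi0 : (0:R) < Num.sqrt pi by rewrite sqrtr_gt0 pi_gt0.
under eq_integral => a _.
  rewrite (_ : (fun x => _) = (fun x : 'rV[R]_n =>
     ((Num.sqrt pi)^-1 * gauss_fun a)%:E * (gauss_rV x)%:E)%E); last first.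
    apply/funext => x; rewrite /gauss_rV sqn_cons_rV opprD expRD -EFinM exprS invfM.
    by rewrite /gauss_fun; congr EFin; ring.
  rewrite ge0_integralZl//; last 3 first.
  - exact: measurable_gauss_rVE.
  - by move=> x _; rewrite lee_fin gauss_rV_ge0.
  - by rewrite lee_fin mulr_ge0 ?gauss_fun_ge0// invr_ge0 ltW.
  rewrite IH mule1 EFinM.
  over.
rewrite ge0_integralZl//; last 2 first.
- by apply/measurable_EFinP; exact: measurable_gauss_fun.
- by move=> x _; rewrite lee_fin gauss_fun_ge0.
by rewrite integralT_gauss -EFinM mulVf// gt_eqF.
Qed.

Let gE n (x : 'rV[R]_n) : \bar R := (gauss_rV x)%:E.

Let gE_ge0 n (x : 'rV[R]_n) : (0 <= gE x)%E.
Proof. by rewrite lee_fin gauss_rV_ge0. Qed.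

Let mgE n : measurable_fun setT (@gE n) := @measurable_gauss_rVE n.

(** Reflection multiplies integrals by some factor; the density is even and of integral 1, so that
    factor is 1. This absorbs the sign of [a] in [gauss_rV_stable]. *)
Lemma gauss_rV_even n (f : 'rV[R]_n -> \bar R) :
  measurable_fun setT f -> (forall x, 0 <= f x)%E ->
  (\int[lebesgue_rV R n]_x (f (- x)%R * (gauss_rV x)%:E) =
   \int[lebesgue_rV R n]_x (f x * (gauss_rV x)%:E))%E.
Proof.
move=> mf f0.
have uA : -1%:M \in @unitmx R n.
  by rewrite unitmxE -scaleN1r detZ det1 mulr1 unitfE expf_neq0// oppr_eq0 oner_eq0.
have [c c0 Hc] := lebesgue_rV_linear uA.
have gN x : gE (x *m - 1%:M) = gE x :> \bar R.
  by rewrite /gE /gauss_rV mulmxN mulmx1 sqnN.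
have c1 : c = 1.
  have := Hc _ (@mgE n) (@gE_ge0 n).
  under eq_integral do rewrite gN.
  by rewrite integral_gauss_rV mule1 => -[].
have := Hc _ (emeasurable_funM mf (@mgE n)) (fun x => mule_ge0 (f0 x) (gE_ge0 x)).
rewrite c1 mul1e => <-.
by apply: eq_integral => x _ /=; rewrite gN mulmxN mulmx1.
Qed.

(* Completing the square:
   |z - b z'|^2 + |z'|^2 = (1 + b^2) |z' - b/(1 + b^2) z|^2 + |z|^2 / (1 + b^2). *)
Let complete_square n (b : R) (z w : 'rV[R]_n) :
  sqn (z - b *: (w + (b / (1 + b ^+ 2)) *: z)) + sqn (w + (b / (1 + b ^+ 2)) *: z) =
  (1 + b ^+ 2) * sqn w + (1 + b ^+ 2)^-1 * sqn z.
Proof.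
have b0 : 1 + b ^+ 2 != 0 by rewrite gt_eqF// ltr_pwDl// sqr_ge0.
rewrite /sqn !mulr_sumr -!big_split/=; apply: eq_bigr => i _; rewrite !mxE.
by field.
Qed.

(** With [t = b / a], shifting [z] by [- t w] frees the argument of [f] from [w]. Completing the
    square in [w] then leaves a Gaussian in [w] times a widened Gaussian in [z], and scaling by [s]
    restores the latter. [D] collects the factors; being independent of [f], it can be evaluated
    afterwards on a constant. *)
Let stable_aux n (a b : R) : a != 0 ->
  exists2 D : \bar R, (0 <= D)%E & forall f : 'rV[R]_n -> \bar R,
  measurable_fun setT f -> (forall x, 0 <= f x)%E ->
  (\int[lebesgue_rV R n]_z \int[lebesgue_rV R n]_w (f (a *: z + b *: w)%R * (gE z * gE w)) =
   D * \int[lebesgue_rV R n]_z (f ((a * Num.sqrt (1 + (b / a) ^+ 2)) *: z)%R * gE z))%E.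
Proof.
move=> a0; set t := b / a; set s := Num.sqrt _.
have t0 : 0 < 1 + t ^+ 2 by rewrite ltr_pwDl// sqr_ge0.
have s0 : 0 < s by rewrite sqrtr_gt0.
pose E (w : 'rV[R]_n) : \bar R := ((Num.sqrt pi) ^- n * expR (- ((1 + t ^+ 2) * sqn w)))%:E.
have E0 w : (0 <= E w)%E.
  by rewrite lee_fin mulr_ge0 ?expR_ge0// invr_ge0 exprn_ge0// sqrtr_ge0.
have mE : measurable_fun setT E.
  apply/measurable_EFinP; apply: measurable_funM => //; apply: measurableT_comp => //.
  apply: measurableT_comp => //; apply: measurable_funM => //; exact: measurable_sqn.
exists ((s ^+ n)%:E * \int[lebesgue_rV R n]_w E w)%E.
  by rewrite mule_ge0 ?integral_ge0// lee_fin exprn_ge0// ltW.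
move=> f mf f0.
have mfa (c : R) : measurable_fun setT (fun z : 'rV[R]_n => f (c *: z)).
  by apply: measurableT_comp => //; apply: measurable_scalemx.
have m2 (c : R) (F : 'rV[R]_n -> \bar R) : measurable_fun setT F ->
    measurable_fun setT (fun p : 'rV[R]_n * 'rV[R]_n => F (p.1 + c *: p.2)).
  move=> mF; apply: measurableT_comp => //.
  by apply: measurable_addmx => //; apply: measurable_scalemx.
have mg1 : measurable_fun setT (fun p : 'rV[R]_n * 'rV[R]_n => gE p.1).
  exact: (measurableT_comp (@mgE n)).
have mg2 : measurable_fun setT (fun p : 'rV[R]_n * 'rV[R]_n => gE p.2).
  exact: (measurableT_comp (@mgE n)).
rewrite sigma_finite_fubini/=; last 2 first.
- apply: emeasurable_funM; last exact: emeasurable_funM.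
  apply: measurableT_comp => //.
  by apply: measurable_addmx => //; apply: measurable_scalemx.
- by move=> x y; rewrite !mule_ge0.
transitivity (\int[lebesgue_rV R n]_w \int[lebesgue_rV R n]_z
    (f (a *: z) * (gE (z + (- t) *: w)%R * gE w)))%E.
  apply: eq_integral => w _.
  rewrite -[LHS](lebesgue_rV_shift (- t *: w)); last 2 first.
  - apply: emeasurable_funM; last exact: emeasurable_funM.
    apply: measurableT_comp => //.
    by apply: measurable_addmx => //; apply: measurable_scalemx.
  - by move=> x; rewrite !mule_ge0.
  apply: eq_integral => z _.
  by rewrite scalerDr scalerA mulrN /t mulrCA mulfV// mulr1 -addrA -scalerDl addNr scale0r addr0.
rewrite -sigma_finite_fubini/=; last 2 first.
- apply: emeasurable_funM; first by apply: (measurableT_comp (mfa a)).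
  apply: emeasurable_funM => //; exact: m2.
- by move=> x y; rewrite !mule_ge0.
transitivity (\int[lebesgue_rV R n]_z (f (a *: z) * (gE (s^-1 *: z) * \int[lebesgue_rV R n]_w E w)))%E.
  apply: eq_integral => z _.
  have mgg : measurable_fun setT (fun w : 'rV[R]_n => gE (z + - t *: w) * gE w)%E.
    apply: emeasurable_funM => //; apply: measurableT_comp => //.
    by apply: measurable_addmx => //; apply: measurable_scalemx.
  rewrite ge0_integralZl//; last by move=> w _; rewrite mule_ge0.
  congr (_ * _)%E.
  rewrite -[LHS](lebesgue_rV_shift ((t / (1 + t ^+ 2)) *: z)); last 2 first.
  - exact: mgg.
  - by move=> w; rewrite mule_ge0.
  rewrite -ge0_integralZl; [|exact: measurableT|exact: mE|by move=> w _; exact: E0|exact: gE_ge0].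
  apply: eq_integral => w _.
  rewrite /gE /E -!EFinM; congr EFin; rewrite /gauss_rV sqnZ exprVn sqr_sqrtr ?ltW//.
  rewrite mulrACA [RHS]mulrACA -!expRD -!opprD scaleNr complete_square.
  by rewrite [(1 + t ^+ 2)^-1 * _ + _]addrC.
under eq_integral do rewrite muleA muleC.
have mh : measurable_fun setT (fun z : 'rV[R]_n => f (a *: z) * gE (s^-1 *: z)%R)%E.
  apply: emeasurable_funM => //; apply: measurableT_comp => //.
  by apply: measurable_scalemx.
rewrite ge0_integralZl; [|exact: measurableT|exact: mh|by move=> z _; rewrite mule_ge0|
  by apply: integral_ge0 => w _; exact: E0].
rewrite [in RHS](muleC (s ^+ n)%:E) -[RHS]muleA; congr (_ * _)%E.
have <- : ((s ^+ n)%:E * \int[lebesgue_rV R n]_z (f (a *: (s *: z)) * gE (s^-1 *: (s *: z))%R) =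
   \int[lebesgue_rV R n]_z (f (a *: z) * gE (s^-1 *: z)%R))%E.
  rewrite (lebesgue_rV_scale s0 mh); last by move=> z; rewrite mule_ge0.
  by rewrite muleA -EFinM mulfV ?mul1e// expf_neq0// gt_eqF.
have sV : s^-1 * s = 1 by rewrite mulVf// gt_eqF.
congr (_ * _)%E; apply: eq_integral => z _.
by rewrite !scalerA sV scale1r.
Qed.

(** For [a != 0], testing [stable_aux] on the constant 1 gives [D = 1]. The coefficient found there
    has the right square, hence is right up to a sign, which the evenness of the density removes.
    For [a = 0] the integral over [z] is a factor 1. *)
Lemma gauss_rV_stable n (a b : R) (f : 'rV[R]_n -> \bar R) : 0 <= b ->
  measurable_fun setT f -> (forall x, 0 <= f x)%E ->
  (\int[lebesgue_rV R n]_z \int[lebesgue_rV R n]_w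
     (f (a *: z + b *: w)%R * ((gauss_rV z)%:E * (gauss_rV w)%:E)) =
   \int[lebesgue_rV R n]_z (f (Num.sqrt (a ^+ 2 + b ^+ 2) *: z)%R * (gauss_rV z)%:E))%E.
Proof.
move=> b0 mf f0.
have mfa (c : R) : measurable_fun setT (fun z : 'rV[R]_n => f (c *: z)).
  by apply: measurableT_comp => //; apply: measurable_scalemx.
have [->|a0] := eqVneq a 0.
  rewrite expr0n add0r sqrtr_sqr ger0_norm//.
  under eq_integral => z _.
    under eq_integral do rewrite scale0r add0r muleCA.
    rewrite ge0_integralZl//; last 3 first.
    - exact: emeasurable_funM.
    - by move=> w _; rewrite mule_ge0// lee_fin gauss_rV_ge0.
    - by rewrite lee_fin gauss_rV_ge0.
    rewrite muleC; over.
  rewrite ge0_integralZl//.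
  - by rewrite integral_gauss_rV mule1.
  - by move=> z _; rewrite lee_fin gauss_rV_ge0.
  - by apply: integral_ge0 => z _; rewrite mule_ge0// lee_fin gauss_rV_ge0.
have [D D0 HD] := @stable_aux n a b a0.
have D1 : D = 1%E.
  have := HD (cst 1%E) (measurable_cst _) (fun _ => lee01).
  under eq_integral => z _.
    under eq_integral do rewrite mul1e.
    rewrite ge0_integralZl// integral_gauss_rV mule1; over.
  under [in X in _ = X -> _]eq_integral do rewrite mul1e.
  by rewrite integral_gauss_rV mule1.
rewrite HD// D1 mul1e.
set c := a * _; set s := Num.sqrt (a ^+ 2 + _).
have : c ^+ 2 == s ^+ 2.
  rewrite /c /s exprMn !sqr_sqrtr ?addr_ge0 ?sqr_ge0//.
  by rewrite mulrDr mulr1 exprMn exprVn mulrCA mulfV ?mulr1// expf_neq0.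
rewrite eqf_sqr => /orP[/eqP ->//|/eqP ->].
rewrite -gauss_rV_even//; apply: eq_integral => z _.
by rewrite scaleNr scalerN.
Qed.

End gaussian.

(** * Gaussian matrices *)

Section lebesgue_mx.
Variables (R : realType) (n : nat).
Implicit Types m : nat.

Definition cons_mx m (p : 'rV[R]_n * 'M[R]_(m, n)) : 'M[R]_(m.+1, n) :=
  \matrix_(i, j) (if unlift ord0 i is Some i' then p.2 i' j else p.1 0 j).

Definition uncons_mx m (G : 'M[R]_(m.+1, n)) : 'rV[R]_n * 'M[R]_(m, n) :=
  (row ord0 G, row' ord0 G).

Lemma cons_mx0 m v (G : 'M[R]_(m, n)) j : cons_mx (v, G) ord0 j = v 0 j.
Proof. by rewrite mxE unlift_none. Qed.

Lemma cons_mxS m v (G : 'M[R]_(m, n)) i j : cons_mx (v, G) (lift ord0 i) j = G i j.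
Proof. by rewrite mxE liftK. Qed.

Lemma cons_mxK m : cancel (@cons_mx m) (@uncons_mx m).
Proof.
move=> [v G]; rewrite /uncons_mx; congr pair.
  by apply/rowP => j; rewrite mxE cons_mx0.
by apply/matrixP => i j; rewrite mxE cons_mxS.
Qed.

Lemma uncons_mxK m : cancel (@uncons_mx m) (@cons_mx m).
Proof.
move=> G; apply/matrixP => i j; rewrite /uncons_mx.
by case: (unliftP ord0 i) => [k|] ->; rewrite ?cons_mx0 ?cons_mxS mxE.
Qed.

Lemma measurable_cons_mx m : measurable_fun setT (@cons_mx m).
Proof.
apply/measurable_fun_mxP => i j; under eq_fun do rewrite mxE.
case: (unlift ord0 i) => [k|].
  exact: (measurableT_comp (measurable_mx_coord k j)).
exact: (measurableT_comp (measurable_mx_coord 0 j)).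
Qed.

Lemma measurable_uncons_mx m : measurable_fun setT (@uncons_mx m).
Proof.
apply/measurable_fun_pair; apply/measurable_fun_mxP => i j.
  by under eq_fun do rewrite mxE; exact: measurable_mx_coord.
by under eq_fun do rewrite mxE; exact: measurable_mx_coord.
Qed.

Section step.
Variables (m : nat) (mu : {sigma_finite_measure set 'M[R]_(m, n) -> \bar R}).

Definition lebesgue_mx_step : set 'M[R]_(m.+1, n) -> \bar R :=
  pushforward (lebesgue_rV R n \x mu)%E (@cons_mx m).

Let step0 : lebesgue_mx_step set0 = 0%E.
Proof. by rewrite /lebesgue_mx_step /pushforward preimage_set0 measure0. Qed.

Let step_ge0 A : (0 <= lebesgue_mx_step A)%E.
Proof. by rewrite /lebesgue_mx_step /pushforward; exact: measure_ge0. Qed.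

Let step_sigma_additive : semi_sigma_additive lebesgue_mx_step.
Proof. by apply: measure_semi_sigma_additive; exact: measurable_cons_mx. Qed.

HB.instance Definition _ := isMeasure.Build _ _ _ lebesgue_mx_step
  step0 step_ge0 step_sigma_additive.

Let step_sigma_finite : sigma_finite setT lebesgue_mx_step.
Proof.
apply: (pushforward_sigma_finite (@measurable_uncons_mx m) (@cons_mxK m)).
exact: product_measure1_sigma_finite.
Qed.

HB.instance Definition _ := Measure_isSigmaFinite.Build _ _ _ lebesgue_mx_step
  step_sigma_finite.

End step.

(** Iterated by rows, to match the splitting of [y *m G] into the first coordinate of [y] times the
    first row of [G], plus the same product for the remaining ones. *)
Fixpoint lebesgue_mx m : {sigma_finite_measure set 'M[R]_(m, n) -> \bar R} :=
  match m with
  | 0%N => dirac (0 : 'M[R]_(0, n))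
  | m'.+1 => lebesgue_mx_step (lebesgue_mx m')
  end.

Lemma measurable_cons_mx_pair m (f : 'M[R]_(m.+1, n) -> \bar R) : measurable_fun setT f ->
  measurable_fun setT (fun p : 'rV[R]_n * 'M[R]_(m, n) => f (cons_mx p)).
Proof. by move=> mf; apply: measurableT_comp => //; exact: measurable_cons_mx. Qed.

Lemma integral_cons_mx m (f : 'M[R]_(m.+1, n) -> \bar R) :
  measurable_fun setT f -> (forall x, 0 <= f x)%E ->
  (\int[lebesgue_mx m.+1]_G f G =
   \int[lebesgue_rV R n]_v \int[lebesgue_mx m]_G f (cons_mx (v, G)))%E.
Proof.
move=> mf f0.
rewrite /= /lebesgue_mx_step.
rewrite (@ge0_integral_pushforward _ _ _ _ R _ (@measurable_cons_mx m) _ setT)//.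
rewrite preimage_setT fubini_tonelli1//.
- by apply: measurableT_comp => //; exact: measurable_cons_mx.
- by move=> x; exact: f0.
Qed.

Lemma cons_mxD m v w (G H : 'M[R]_(m, n)) :
  cons_mx (v, G) + cons_mx (w, H) = cons_mx (v + w, G + H).
Proof.
apply/matrixP => i j; rewrite mxE.
by case: (unliftP ord0 i) => [k|] ->; rewrite ?cons_mx0 ?cons_mxS mxE.
Qed.

Lemma cons_rV_mul_mx m a (y : 'rV[R]_m) v (G : 'M[R]_(m, n)) :
  cons_rV (a, y) *m cons_mx (v, G) = a *: v + y *m G.
Proof.
apply/rowP => j; rewrite !mxE big_ord_recl cons_rV0 cons_mx0; congr (_ + _).
by apply: eq_bigr => i _; rewrite cons_rVS cons_mxS.
Qed.

Lemma lebesgue_mx_shift m (H : 'M[R]_(m, n)) (f : 'M[R]_(m, n) -> \bar R) :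
  measurable_fun setT f -> (forall x, 0 <= f x)%E ->
  (\int[lebesgue_mx m]_G f (G + H)%R = \int[lebesgue_mx m]_G f G)%E.
Proof.
elim: m H f => [|m IH] H f mf f0.
  by apply: eq_integral => x _; congr f; rewrite [LHS]flatmx0 [RHS]flatmx0.
rewrite -[H]uncons_mxK; case: (uncons_mx H) => w {}H.
have mfH : measurable_fun setT (fun G : 'M[R]_(m.+1, n) => f (G + cons_mx (w, H))).
  by apply: measurableT_comp => //; apply: measurable_addmx.
rewrite !integral_cons_mx//.
under eq_integral => v _.
  under eq_integral do rewrite cons_mxD.
  rewrite (IH H (fun G => f (cons_mx (v + w, G))))//; last first.
    apply: (measurableT_comp (measurable_cons_mx_pair mf)).
    by apply/measurable_fun_pair.
  over.
rewrite (lebesgue_rV_shift w (f := fun v => \int[lebesgue_mx m]_G f (cons_mx (v, G)))%E)//.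
  exact: (measurable_fun_fubini_tonelli_F (fun p => f (cons_mx p)) (measurable_cons_mx_pair mf)).
by move=> a; apply: integral_ge0.
Qed.

Definition gauss_mx m (G : 'M[R]_(m, n)) : R := \prod_i gauss_rV (row i G).

Lemma gauss_mx_gt0 m (G : 'M[R]_(m, n)) : 0 < gauss_mx G.
Proof. by apply: prodr_gt0 => i _; exact: gauss_rV_gt0. Qed.

Lemma gauss_mx_ge0 m (G : 'M[R]_(m, n)) : 0 <= gauss_mx G.
Proof. exact/ltW/gauss_mx_gt0. Qed.

Lemma measurable_gauss_mx m : measurable_fun setT (@gauss_mx m).
Proof.
apply: measurable_prod => i _; apply: (measurableT_comp (@measurable_gauss_rV R n)).
by apply/measurable_fun_mxP => k j; under eq_fun do rewrite mxE; exact: measurable_mx_coord.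
Qed.

Lemma gauss_mx_cons m v (G : 'M[R]_(m, n)) :
  gauss_mx (cons_mx (v, G)) = gauss_rV v * gauss_mx G.
Proof.
rewrite /gauss_mx big_ord_recl; congr (_ * _).
  by congr gauss_rV; apply/rowP => j; rewrite mxE cons_mx0.
apply: eq_bigr => i _; congr gauss_rV.
by apply/rowP => j; rewrite !mxE liftK.
Qed.

Lemma measurable_gauss_mxE m :
  measurable_fun setT (fun G : 'M[R]_(m, n) => (gauss_mx G)%:E).
Proof. exact: (iffRL (measurable_EFinP _ _) (@measurable_gauss_mx m)). Qed.

(** Induction on the rows: the induction hypothesis replaces the contribution of the later rows by
    [|y|] times one Gaussian vector, and stability merges it with [a v], because [a ^+ 2 + |y| ^+ 2]
    is the squared length of the row vector [(a, y)]. *)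
Lemma integral_gauss_mx m (y : 'rV[R]_m) (f : 'rV[R]_n -> \bar R) :
  measurable_fun setT f -> (forall x, 0 <= f x)%E ->
  (\int[lebesgue_mx m]_G (f (y *m G)%R * (gauss_mx G)%:E) =
   \int[lebesgue_rV R n]_z (f (enorm y *: z)%R * (gauss_rV z)%:E))%E.
Proof.
elim: m y f => [|m IH] y f mf f0.
  have mh : measurable_fun setT (fun G : 'M[R]_(0, n) => f (y *m G) * (gauss_mx G)%:E)%E.
    apply: emeasurable_funM; last exact: measurable_gauss_mxE.
    by apply: measurableT_comp => //; apply: measurable_mulmx.
  rewrite integral_dirac// diracT mul1e mulmx0.
  have -> : enorm y = 0 by rewrite [y]thinmx0; apply/eqP; rewrite enorm_eq0.
  under eq_integral do rewrite scale0r.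
  rewrite ge0_integralZl//.
  - by rewrite integral_gauss_rV /gauss_mx big_ord0.
  - exact: measurable_gauss_rVE.
  - by move=> z _; rewrite lee_fin gauss_rV_ge0.
move: y; apply: cons_rVP => a y.
have mh : measurable_fun setT (fun G : 'M[R]_(m.+1, n) =>
    f (cons_rV (a, y) *m G) * (gauss_mx G)%:E)%E.
  apply: emeasurable_funM; last exact: measurable_gauss_mxE.
  by apply: measurableT_comp => //; apply: measurable_mulmx.
rewrite integral_cons_mx//; last first.
  by move=> G; rewrite mule_ge0// lee_fin gauss_mx_ge0.
have -> : enorm (cons_rV (a, y)) = Num.sqrt (a ^+ 2 + enorm y ^+ 2).
  by rewrite /enorm sqn_cons_rV sqr_sqrtr// sqn_ge0.
rewrite -gauss_rV_stable ?enorm_ge0//.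
apply: eq_integral => v _.
have mfv : measurable_fun setT (fun z : 'rV[R]_n => f (a *: v + z)).
  by apply: measurableT_comp => //; apply: measurable_addmx.
transitivity ((gauss_rV v)%:E * \int[lebesgue_mx m]_G (f (a *: v + y *m G)%R * (gauss_mx G)%:E))%E.
  rewrite -ge0_integralZl.
  - by apply: eq_integral => G _; rewrite cons_rV_mul_mx gauss_mx_cons EFinM muleCA.
  - exact: measurableT.
  - apply: emeasurable_funM; last exact: measurable_gauss_mxE.
    by apply: (measurableT_comp mfv); apply: measurable_mulmx.
  - by move=> G _; rewrite mule_ge0// lee_fin gauss_mx_ge0.
  - by rewrite lee_fin gauss_rV_ge0.
rewrite (IH y (fun z => f (a *: v + z)))//.
rewrite -ge0_integralZl.
- by apply: eq_integral => w _; rewrite muleCA.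
- exact: measurableT.
- apply: emeasurable_funM; last exact: measurable_gauss_rVE.
  by apply: (measurableT_comp mfv); apply: measurable_scalemx.
- by move=> G _; rewrite mule_ge0// lee_fin gauss_rV_ge0.
- by rewrite lee_fin gauss_rV_ge0.
Qed.

Lemma finite_root (p : {poly R}) : p != 0 -> finite_set [set s | root p s].
Proof.
move=> p0; apply: contrapT => /(infinite_set_fset (size p))[A AP sA].
have : (size (finmap.enum_fset A) < size p)%N.
  apply: max_poly_roots => //; last exact: finmap.fset_uniq.
  by apply/allP => x xA; exact: AP.
by rewrite ltnNge sA.
Qed.

Lemma measurable_det m d (T : measurableType d) (f : T -> 'M[R]_m) :
  measurable_fun setT f -> measurable_fun setT (fun x => \det (f x)).
Proof.
move=> /measurable_fun_mxP mf; apply: measurable_sum => s.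
by apply: measurable_funM => //; apply: measurable_prod => i _; exact: mf.
Qed.

(* A translate of a degenerate G by a multiple of J is degenerate only for the finitely
   many roots of a characteristic polynomial. *)
Lemma degenerate_mx_null m (J : 'M[R]_(m, n)) : J *m J^T = 1%:M ->
  measurable [set G : 'M[R]_(m, n) | \det (G *m J^T) = 0] /\
  lebesgue_mx m [set G | \det (G *m J^T) = 0] = 0%E.
Proof.
move=> JJ; set D := [set G | _].
have mD : measurable D.
  rewrite (_ : D = setT `&` (fun G : 'M[R]_(m, n) => \det (G *m J^T)) @^-1` [set 0]).
    have : measurable_fun setT (fun G : 'M[R]_(m, n) => \det (G *m J^T)).
      by apply: measurable_det; apply: measurable_mulmx.
    by apply.
  by rewrite setTI.
split=> //.
pose c G : \bar R := (\1_D G)%:E.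
have mc : measurable_fun setT c by apply/measurable_EFinP; exact: measurable_indic.
have c0 G : (0 <= c G)%E by rewrite lee_fin.
have mcs : measurable_fun setT (fun p : measurableTypeR R * 'M[R]_(m, n) => c (p.2 + p.1 *: J)).
  by apply: measurableT_comp => //; apply: measurable_addmx => //; apply: measurable_scalemx.
have E : (\int[lebesgue_measure]_s \int[lebesgue_mx m]_G c (G + s *: J)%R =
          \int[lebesgue_mx m]_G \int[lebesgue_measure]_s c (G + s *: J)%R)%E.
  exact: (sigma_finite_fubini _ _ mcs).
have R0 : (\int[lebesgue_mx m]_G \int[lebesgue_measure]_s c (G + s *: J)%R = 0)%E.
  apply: integral0_eq => G _.
  pose Z : set (measurableTypeR R) := [set s | D (G + s *: J)].
  have mZ : measurable Z.
    rewrite (_ : Z = setT `&` (fun s : measurableTypeR R => G + s *: J) @^-1` D).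
      have : measurable_fun setT (fun s : measurableTypeR R => G + s *: J).
        by apply: measurable_addmx => //; apply: measurable_scalemx.
      by apply.
    by rewrite setTI.
  rewrite (_ : (fun _ => _) = fun s => (\1_Z s)%:E); last first.
    by apply/funext => s; rewrite /c !indicE.
  rewrite integral_indic// setIT.
  apply: countable_lebesgue_measure0; apply: finite_set_countable.
  (* Since [J J^T = 1], the determinant of [(G + s J) J^T = s + G J^T] is the characteristic
     polynomial of [- G J^T] evaluated at [s]. *)
  have p0 : char_poly (- (G *m J^T)) != 0 by rewrite monic_neq0// char_poly_monic.
  apply: sub_finite_set (finite_root p0) => s /=.
  rewrite /Z/= /D/= => Ds; rewrite rootE; apply/eqP; rewrite -[RHS]Ds.
  rewrite -[LHS]/(horner_eval s _) -det_map_mx; congr (\det _).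
  rewrite mulmxDl -scalemxAl JJ.
  apply/matrixP => i j; rewrite !mxE/= /horner_eval.
  by rewrite hornerD hornerN hornerMn hornerX hornerC opprK addrC mulr_natr.
(* By translation invariance the integral over [G] equals the measure of [D] for every [s]; a
   nonzero constant would have an infinite integral over the line. *)
apply/eqP/negP => /negP nz.
have : (\int[lebesgue_measure]_(s in [set: measurableTypeR R]) cst (lebesgue_mx m D) s = 0)%E.
  rewrite -R0 -E; apply: eq_integral => s _.
  by rewrite lebesgue_mx_shift// integral_indic// setIT.
rewrite integral_cst// => H.
have lT : lebesgue_measure [set: measurableTypeR R] = +oo%E :> \bar R.
  by rewrite -set_itvNyy lebesgue_measure_itv.
have : (lebesgue_mx m D * +oo = 0)%E by rewrite -H -lT.
by rewrite gt0_muley// lt_neqAle eq_sym nz/=; exact: measure_ge0.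
Qed.

End lebesgue_mx.

(** * Dyadic estimates of radial integrals *)

Section dyadic.
Variable R : realType.
Implicit Types (m n k : nat) (r t : R).

Definition eball n r : set 'rV[R]_n := [set x | enorm x <= r].

Lemma measurable_eball n r : measurable (@eball n r).
Proof.
rewrite (_ : @eball n r = setT `&` (@enorm R n) @^-1` `]-oo, r]%classic).
  by have := @measurable_enorm R n; apply.
by rewrite setTI; apply/seteqP; split=> x; rewrite /eball/= in_itv.
Qed.

Lemma euclidean_ballE n : @euclidean_ball R n = eball 1.
Proof.
apply/seteqP; split=> x; rewrite /eball /euclidean_ball/= -/(sqn x) /enorm => H.
  by rewrite -sqrtr1 ler_sqrt.
by rewrite -(sqr_sqrtr (sqn_ge0 x)) expr_le1// sqrtr_ge0.
Qed.

Lemma coord_le_enorm n (x : 'rV[R]_n) i : `|x 0 i| <= enorm x.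
Proof.
rewrite -sqrtr_sqr ler_sqrt ?sqn_ge0// /sqn (bigD1 i)//= lerDl.
by apply: sumr_ge0 => j _; exact: sqr_ge0.
Qed.

Lemma eball_cube n r : @eball n r `<=` cube r.
Proof.
move=> x /= xr i; rewrite in_itv/= -ler_norml; exact: le_trans (coord_le_enorm x i) xr.
Qed.

(** The squares of the coordinates add up to at most [n / (n + 1)]; taking [n.+1] also covers
    [n = 0]. *)
Lemma cube_eball n : @cube R n (n.+1%:R^-1) `<=` eball 1.
Proof.
move=> x Hx; rewrite /eball/= -sqrtr1 ler_sqrt//.
apply: (@le_trans _ _ (\sum_(i < n) (n.+1%:R^-1))).
  apply: ler_sum => i _; have := Hx i; rewrite in_itv/= -ler_norml => xi.
  rewrite -real_normK ?num_real// expr2.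
  have n1 : (n.+1%:R^-1 : R) <= 1 by rewrite invf_le1// ler1n.
  have xi1 : `|x 0 i| <= 1 := le_trans xi n1.
  by apply: le_trans xi; rewrite ler_piMl.
rewrite sumr_const card_ord -[leLHS]mulr_natr ler_pdivrMl// mulr1.
by rewrite ler_nat.
Qed.

Definition omega n : R := fine (lebesgue_rV R n (@euclidean_ball R n)).

(** The ball lies between two cubes, so its volume is positive and finite. *)
Lemma omegaE_gt0 n : 0 < omega n /\ lebesgue_rV R n (@euclidean_ball R n) = (omega n)%:E.
Proof.
have mB := @measurable_eball n 1.
have n0 : (0 : R) < n.+1%:R^-1 by rewrite invr_gt0.
have lo : ((((2 * n.+1%:R^-1) ^+ n)%:E : \bar R) <= lebesgue_rV R n (@eball n 1))%E.
  rewrite -(lebesgue_cube n (ltW n0)); apply: (@le_measure _ _ _ (lebesgue_rV R n)).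
  - by rewrite inE; exact: measurable_cube.
  - by rewrite inE.
  - exact: cube_eball.
have hi : (lebesgue_rV R n (@eball n 1) <= ((2 * 1) ^+ n)%:E)%E.
  rewrite -(lebesgue_cube n ler01); apply: (@le_measure _ _ _ (lebesgue_rV R n)).
  - by rewrite inE.
  - by rewrite inE; exact: measurable_cube.
  - exact: eball_cube.
have gt0 : (0 < lebesgue_rV R n (@eball n 1))%E.
  by apply: lt_le_trans lo; rewrite lte_fin exprn_gt0// mulr_gt0.
have fin : lebesgue_rV R n (@eball n 1) \is a fin_num.
  by rewrite ge0_fin_numE ?ltW//; apply: le_lt_trans hi _; rewrite ltry.
by rewrite /omega euclidean_ballE fineK//; split=> //; rewrite fine_gt0// gt0/= ltey_eq fin.
Qed.

Lemma omega_gt0 n : 0 < omega n. Proof. by have [] := omegaE_gt0 n. Qed.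

Lemma lebesgue_euclidean_ball n :
  lebesgue_rV R n (@euclidean_ball R n) = (omega n)%:E.
Proof. by have [] := omegaE_gt0 n. Qed.

Lemma integral_eball n r : 0 < r ->
  (\int[lebesgue_rV R n]_x (\1_(eball r) x)%:E = (r ^+ n * omega n)%:E)%E.
Proof.
move=> r0.
have m1 : measurable_fun setT (fun x : 'rV[R]_n => (\1_(eball 1) x : R)%:E).
  by apply/measurable_EFinP; apply: measurable_indic; exact: measurable_eball.
have r1 : 0 < r^-1 by rewrite invr_gt0.
transitivity (\int[lebesgue_rV R n]_x (\1_(eball 1) (r^-1 *: x))%:E : \bar R)%E.
  apply: eq_integral => x _; rewrite !indicE.
  suff -> : (x \in eball r) = (r^-1 *: x \in eball 1) by [].
  by apply/idP/idP; rewrite !inE /eball/= enormZ gtr0_norm// ler_pdivrMl// mulr1.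
rewrite (lebesgue_rV_scale r1 m1); last by move=> x; rewrite lee_fin.
rewrite exprVn invrK EFinM; congr (_ * _)%E.
rewrite integral_indic//; last exact: measurable_eball.
by rewrite setIT -euclidean_ballE -lebesgue_euclidean_ball.
Qed.

(** A substitute for polar coordinates, used both near the origin and at infinity. [h] is dominated
    by the sum of [c j] times the indicator of the ball of radius [r j]; the overlap of the balls is
    harmless, all terms being non-negative. The term [j] has integral at most
    [A * omega n / 2 ^+ j], and these bounds sum to [2 * A * omega n]. *)
Lemma dyadic_bound n (h : 'rV[R]_n -> \bar R) (r c : nat -> R) (A : R) :
  measurable_fun setT h -> (forall x, 0 <= h x)%E -> 0 <= A ->
  (forall j, 0 < r j) -> (forall j, 0 <= c j) ->
  (forall j, c j * r j ^+ n <= A / 2 ^+ j) ->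
  (forall x, h x = 0%E \/ exists j, enorm x <= r j /\ (h x <= (c j)%:E)%E) ->
  (\int[lebesgue_rV R n]_x h x <= (2 * A * omega n)%:E)%E.
Proof.
move=> mh h0 A0 r0 c0 crA hx.
pose s j (x : 'rV[R]_n) : \bar R := ((c j)%:E * (\1_(eball (r j)) x)%:E)%E.
have s0 j x : (0 <= s j x)%E by rewrite /s mule_ge0// lee_fin.
have m1 j : measurable_fun setT (fun x : 'rV[R]_n => (\1_(eball (r j)) x : R)%:E).
  by apply/measurable_EFinP; apply: measurable_indic; exact: measurable_eball.
have ms j : measurable_fun setT (s j) by apply: emeasurable_funM.
apply: (@le_trans _ _ (\int[lebesgue_rV R n]_x \sum_(0 <= j <oo) s j x)%E).
  apply: ge0_le_integral => //.
  - by apply: ge0_emeasurable_sum => // j x _ _; exact: s0.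
  - move=> x _; have [->|[j [xr hc]]] := hx x.
      by apply: nneseries_ge0 => *; exact: s0.
    apply: le_trans hc _; apply: le_trans (nneseries_lim_ge j.+1 _); last by move=> *; exact: s0.
    rewrite big_nat_recr//=.
    have -> : s j x = (c j)%:E.
      by rewrite /s indicE mem_set ?mule1//.
    by rewrite leeDr// sume_ge0.
rewrite integral_nneseries//.
have o0 := omega_gt0 n.
(* The bound [A * omega n / 2 ^+ j] is written with [2 ^ j.+1] below and the compensating 2 above,
   the shape that [epsilon_trick] sums. *)
apply: (@le_trans _ _ (\sum_(0 <= j <oo) (0 + ((2 * A * omega n) / (2 ^ j.+1)%:R)%:E))%E).
  apply: lee_nneseries => [j _ _|j _]; first by apply: integral_ge0 => x _; exact: s0.
  rewrite add0e /s ge0_integralZl//; last by rewrite lee_fin.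
  rewrite integral_eball// -EFinM lee_fin.
  have -> : 2 * A * omega n / (2 ^ j.+1)%:R = (A / 2 ^+ j) * omega n.
    rewrite expnS natrM natrX; field.
    by rewrite expf_neq0.
  by rewrite mulrA ler_pM2r.
apply: le_trans (epsilon_trick _ _ _) _ => //.
  by rewrite !mulr_ge0// ltW.
by rewrite eseries0// add0e.
Qed.

Lemma dyadic_exists t : 1 <= t -> exists j, 2 ^+ j <= t < 2 ^+ j.+1.
Proof.
move=> t1.
have ex : exists j, t < 2 ^+ j.+1.
  exists (Num.truncn t); apply: lt_trans (truncnS_gt t) _.
  by rewrite -natrX ltr_nat ltn_expl.
exists (ex_minn ex); case: ex_minnP => j tj jmin; rewrite tj andbT.
case: j jmin {tj} => [|j] jmin; first by rewrite expr0.
by rewrite leNgt; apply/negP => /jmin; rewrite ltnn.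
Qed.

Lemma measurable_enormV n k : measurable_fun setT (fun x : 'rV[R]_n => enorm x ^- k).
Proof.
rewrite (_ : (fun _ => _) = fun x : 'rV[R]_n => enorm x `^ (- k%:R)).
  apply: (measurableT_comp (@measurable_powR R _)); exact: measurable_enorm.
by apply/funext => x; rewrite powR_invn// enorm_ge0.
Qed.

Lemma measurable_enormVE n k :
  measurable_fun setT (fun x : 'rV[R]_n => (enorm x ^- k)%:E).
Proof. exact: (iffRL (measurable_EFinP _ _) (@measurable_enormV n k)). Qed.

Lemma enormV_ge0 n k (x : 'rV[R]_n) : 0 <= enorm x ^- k.
Proof. by rewrite invr_ge0 exprn_ge0// enorm_ge0. Qed.

(** On the layer [r / 2 ^+ j.+1 < |x| <= r / 2 ^+ j] the weight is at most [(2 ^+ j.+1 / r) ^+ k].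
    The products [c j * r j ^+ n] decay like [2 ^- (j (n - k))], at least geometrically with ratio
    1/2 since [k < n]. The loss [2 ^+ k.+1] is exponential in [k], like the factor [C ^+ k] of the
    conclusion. *)
Lemma integral_enormV_ball n k r : 0 < r -> (0 < k < n)%N ->
  (\int[lebesgue_rV R n]_x ((\1_(eball r) x)%:E * (enorm x ^- k)%:E) <=
   (2 * (2 ^+ k * r ^+ (n - k)) * omega n)%:E)%E.
Proof.
move=> r0 /andP[k0 kn].
have m1 : measurable_fun setT (fun x : 'rV[R]_n => (\1_(eball r) x : R)%:E).
  by apply/measurable_EFinP; apply: measurable_indic; exact: measurable_eball.
apply: (@dyadic_bound n _ (fun j => r / 2 ^+ j) (fun j => (2 ^+ j.+1 / r) ^+ k)).
- by apply: emeasurable_funM => //; exact: measurable_enormVE.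
- by move=> x; rewrite mule_ge0// lee_fin// enormV_ge0.
- by rewrite mulr_ge0// exprn_ge0// ltW.
- by move=> j; rewrite divr_gt0// exprn_gt0.
- by move=> j; rewrite exprn_ge0// divr_ge0 ?exprn_ge0// ltW.
- move=> j.
  have -> : (2 ^+ j.+1 / r) ^+ k * (r / 2 ^+ j) ^+ n =
            2 ^+ k * r ^+ (n - k) / (2 ^+ j) ^+ (n - k).
    rewrite -{1}(subnKC (ltnW kn)) exprD.
    have r00 : r != 0 by rewrite gt_eqF.
    rewrite exprS !exprMn !exprVn; field.
    by rewrite !expf_neq0.
  rewrite ler_pM2l ?mulr_gt0 ?exprn_gt0// lef_pV2 ?posrE ?exprn_gt0//.
  by rewrite ler_eXnr ?subn_gt0// exprn_ege1// ler1n.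
- move=> x; have [xr|xr] := boolP (x \in eball r); last first.
    by left; rewrite indicE (negbTE xr) mul0e.
  have [->|x0] := eqVneq x 0.
    left; have -> : enorm (0 : 'rV[R]_n) = 0 by apply/eqP; rewrite enorm_eq0.
    by rewrite expr0n gtn_eqF//= invr0 mule0.
  have x0' : 0 < enorm x by rewrite enorm_gt0.
  have xr' : enorm x <= r by move: xr; rewrite inE.
  have [|j /andP[j1 j2]] := @dyadic_exists (r / enorm x).
    by rewrite ler_pdivlMr// mul1r.
  right; exists j; split.
    by rewrite ler_pdivlMr ?exprn_gt0// mulrC -ler_pdivlMr.
  have jr : 0 <= 2 ^+ j.+1 / r by rewrite divr_ge0 ?exprn_ge0// ltW.
  have xj : (enorm x)^-1 <= 2 ^+ j.+1 / r by rewrite ler_pdivlMr// mulrC ltW.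
  by rewrite indicE xr mul1e lee_fin -exprVn lerXn2r// nnegrE invr_ge0 ltW.
Qed.

(** Up to the factor [pi] to the power [- n / 2], this is the density of [|y| Z], with [Z] Gaussian
    in [R^n], at distance [t] from the origin, regarded as a function of [y]. *)
Definition gauss_tail m n (t : R) (y : 'rV[R]_m) : R :=
  enorm y ^- n * expR (- (t / enorm y) ^+ 2).

Lemma gauss_tail_ge0 m n t (y : 'rV[R]_m) : 0 <= gauss_tail n t y.
Proof. by rewrite mulr_ge0 ?enormV_ge0 ?expR_ge0. Qed.

Lemma measurable_gauss_tail m n t : measurable_fun setT (@gauss_tail m n t).
Proof.
apply: measurable_funM; first exact: measurable_enormV.
apply: measurableT_comp => //; apply: measurableT_comp => //.
apply: measurable_funX; apply: measurable_funM => //.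
exact: (@measurable_enormV m 1).
Qed.

Lemma measurable_gauss_tailE m n t :
  measurable_fun setT (fun y : 'rV[R]_m => (gauss_tail n t y)%:E).
Proof. exact: (iffRL (measurable_EFinP _ _) (@measurable_gauss_tail m n t)). Qed.

(** For [u > 1] the exponential series gives [u ^+ n <= n! * expR u], and [u <= u ^+ 2]. With
    [u = 1 / |y|] this keeps [gauss_tail] bounded near [y = 0]. *)
Lemma exprn_gauss_le n (u : R) : (0 < n)%N -> 0 <= u ->
  u ^+ n * expR (- u ^+ 2) <= n`!%:R.
Proof.
case: n => // n _ u0.
have f1 : (1 : R) <= (n.+1)`!%:R by rewrite ler1n fact_gt0.
have [u1|u1] := leP u 1.
  apply: le_trans f1; rewrite mulr_ile1 ?exprn_ge0 ?expR_ge0 ?exprn_ile1//.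
  by rewrite expR_le1 oppr_le0 sqr_ge0.
rewrite expRN ler_pdivrMr ?expR_gt0//.
apply: (@le_trans _ _ ((n.+1)`!%:R * expR u)).
  rewrite mulrC -ler_pdivrMr ?ltr0n ?fact_gt0//.
  by apply: le_trans (expR_ge1Dxn n u0); rewrite lerDr.
rewrite ler_wpM2l// ler_expR ler_eXnr// ltW//.
Qed.

(* Scaling gives the power t^(m - n); finiteness at infinity needs m < n. *)
Lemma integral_gauss_tail m n : (0 < m < n)%N -> exists2 w : R, 0 < w &
  forall t, 0 < t -> (\int[lebesgue_rV R m]_y (gauss_tail n t y)%:E = (w * t ^- (n - m))%:E)%E.
Proof.
move=> /andP[m0 mn]; have n0 : (0 < n)%N by exact: leq_ltn_trans mn.
pose I t : \bar R := (\int[lebesgue_rV R m]_y (gauss_tail n t y)%:E)%E.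
have g0 t (y : 'rV[R]_m) : (0 <= (gauss_tail n t y)%:E)%E by rewrite lee_fin gauss_tail_ge0.
have hi : (I 1%R <= (2 * (n`!%:R * 2 ^+ m) * omega m)%:E)%E.
  (* Layers [2 ^+ j <= |y| < 2 ^+ j.+1], the unit ball being added to the layer [j = 0]. In the unit
     ball [exprn_gauss_le] bounds the integrand by [n!]; outside, the exponential is at most 1. The
     products [c j * r j ^+ m] decay because [m < n]. *)
  apply: (@dyadic_bound m _ (fun j => 2 ^+ j.+1) (fun j => n`!%:R / (2 ^+ j) ^+ n)) => //.
  - exact: measurable_gauss_tailE.
  - move=> j.
    have -> : n`!%:R / (2 ^+ j) ^+ n * (2 ^+ j.+1) ^+ m =
              n`!%:R * 2 ^+ m / (2 ^+ j) ^+ (n - m) :> R.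
      rewrite -{2}(subnK (ltnW mn)) exprD exprS exprMn; field.
      by rewrite !expf_neq0.
    rewrite ler_pM2l ?mulr_gt0 ?exprn_gt0 ?ltr0n ?fact_gt0//.
    rewrite lef_pV2 ?posrE ?exprn_gt0//.
    by rewrite ler_eXnr ?subn_gt0// exprn_ege1// ler1n.
  - move=> y; right; have [y2|y2] := leP (enorm y) 1.
      exists 0%N; split; first by rewrite expr1; lra.
      rewrite lee_fin /gauss_tail expr0 expr1n divr1 div1r -exprVn.
      by apply: exprn_gauss_le => //; rewrite invr_ge0 enorm_ge0.
    have [|j /andP[j1 j2]] := @dyadic_exists (enorm y); first exact: ltW.
    exists j; split; first exact: ltW.
    rewrite lee_fin /gauss_tail mulrC.
    have P1 : enorm y ^- n <= (2 ^+ j) ^- n.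
      rewrite lef_pV2 ?posrE ?exprn_gt0 ?enorm_gt0//; last first.
        by rewrite -enorm_gt0; apply: lt_trans y2.
      by rewrite lerXn2r ?nnegrE ?exprn_ge0// enorm_ge0.
    apply: ler_pM => //; rewrite ?expR_ge0 ?enormV_ge0//.
    apply: (@le_trans _ _ 1); last by rewrite ler1n fact_gt0.
    by rewrite expR_le1 oppr_le0 sqr_ge0.
have ind r : measurable_fun setT (fun y : 'rV[R]_m => (\1_(eball r) y : R)%:E).
  by apply/measurable_EFinP; apply: measurable_indic; exact: measurable_eball.
have lo : (0 < I 1%R)%E.
  have I1_ge0 : (0 <= I 1%R)%E by apply: integral_ge0 => y _; exact: g0.
  rewrite lt_neqAle I1_ge0 andbT.
  apply/eqP => I0.
  (* The integrand is at least [c] on the shell [1 < |y| <= 2]. If its integral were 0, the ball of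
     radius 2 would have no more volume than the unit ball, against [0 < m]. *)
  pose c : R := 2 ^- n * expR (- 1).
  have c0 : 0 < c by rewrite mulr_gt0 ?expR_gt0// invr_gt0 exprn_gt0.
  have : (\int[lebesgue_rV R m]_y (c%:E * (\1_(eball 2) y)%:E) <=
     \int[lebesgue_rV R m]_y ((gauss_tail n 1 y)%:E + c%:E * (\1_(eball 1) y)%:E))%E.
    apply: ge0_le_integral => //.
    - by move=> y _; rewrite mule_ge0// lee_fin// ltW.
    - exact: emeasurable_funM.
    - by apply: emeasurable_funD; [exact: measurable_gauss_tailE|exact: emeasurable_funM].
    move=> y _; rewrite -!EFinM -EFinD lee_fin !indicE.
    have [y1|y1] := boolP (y \in eball 1).
      rewrite mulr1; apply: (@le_trans _ _ c); last by rewrite lerDr gauss_tail_ge0.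
      by case: (_ \in _); rewrite ?mulr1// mulr0 ltW.
    rewrite mulr0 addr0; have [y2|y2] := boolP (y \in eball 2); last first.
      by rewrite mulr0 gauss_tail_ge0.
    have {}y2 : enorm y <= 2 by move: y2; rewrite inE.
    have {}y1 : 1 < enorm y by move: y1; rewrite notin_setE /eball/= => /negP; rewrite -ltNge.
    have y0 : 0 < enorm y by apply: lt_trans y1.
    rewrite mulr1 /c /gauss_tail; apply: ler_pM; rewrite ?expR_ge0 ?invr_ge0 ?exprn_ge0//.
      by rewrite lef_pV2 ?posrE ?exprn_gt0// lerXn2r ?nnegrE// ltW.
    by rewrite ler_expR lerN2 exprn_ile1// div1r ?invr_ge0 ?invf_le1// ltW.
  rewrite ge0_integralD//; last 3 first.
  - exact: measurable_gauss_tailE.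
  - by move=> y _; rewrite mule_ge0// lee_fin// ltW.
  - exact: emeasurable_funM.
  rewrite -/(I 1) -I0 add0e !ge0_integralZl//; [|by rewrite lee_fin ltW..].
  rewrite !integral_eball// expr1n mul1r -!EFinM lee_fin ler_pM2l//.
  rewrite -[leRHS]mul1r ler_pM2r ?omega_gt0// leNgt exprn_egt1// ?ltr1n//.
  by rewrite negbK => /eqP mE; move: m0; rewrite mE.
have fin : I 1 \is a fin_num.
  by rewrite ge0_fin_numE ?ltW//; apply: le_lt_trans hi _; rewrite ltry.
exists (fine (I 1)); first by rewrite fine_gt0// lo/= ltey_eq fin.
move=> t t0; rewrite EFinM fineK// /I.
have -> : (t ^- (n - m))%:E = ((t ^+ m) * t ^- n)%:E :> \bar R.
  have t00 : t != 0 by rewrite gt_eqF.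
  rewrite -{2}(subnK (ltnW mn)) exprD; congr EFin; field.
  by rewrite !expf_neq0.
have := lebesgue_rV_scale t0 (@measurable_gauss_tailE m n t) (g0 t).
move=> /(congr1 (fun z => (t ^+ m)%:E * z)%E).
rewrite muleA -EFinM mulfV ?mul1e; last by rewrite expf_neq0// gt_eqF.
move=> <-; rewrite EFinM muleCA; congr (_ * _)%E.
rewrite muleC -ge0_integralZl//.
- apply: eq_integral => y _; rewrite -EFinM /gauss_tail enormZ gtr0_norm//.
  rewrite exprMn invfM mulrA; congr (_ * expR (- _ ^+ 2))%:E.
  by rewrite invfM mulrA mulfV// gt_eqF.
- exact: measurable_gauss_tailE.
- by rewrite lee_fin invr_ge0 exprn_ge0// ltW.
Qed.

End dyadic.

Arguments omega {R} n.

(** * Averaging over subspaces *)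

Section average.
Variable R : realType.
Implicit Types (m n k : nat) (M : R).

(** The origin is the cube of side 0. It has to be discarded because [enorm] is inverted below, and
    its inverse has a default value there. *)
Lemma ae_neq0_rV n (P : 'rV[R]_n -> Prop) : (0 < n)%N ->
  (forall x, x != 0 -> P x) -> {ae lebesgue_rV R n, forall x, P x}.
Proof.
move=> n0 HP; exists (cube 0); split.
- exact: measurable_cube.
- by apply: etrans (lebesgue_cube n (lexx 0)) _; rewrite mulr0 expr0n gtn_eqF.
- move=> x /= nPx i; have [x0|/HP//] := eqVneq x 0.
  by rewrite x0 mxE in_itv/= oppr0 lexx.
Qed.

Lemma gauss_rV_tail m n (x : 'rV[R]_n) (y : 'rV[R]_m) :
  enorm y ^- n * gauss_rV ((enorm y)^-1 *: x) =
  Num.sqrt pi ^- n * gauss_tail n (enorm x) y.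
Proof.
rewrite /gauss_rV /gauss_tail mulrCA; congr (_ * (_ * expR (- _))).
by rewrite sqnZ exprMn enorm_sqr mulrC.
Qed.

Lemma measurable_gauss_tail_pair m n :
  measurable_fun setT (fun p : 'rV[R]_m * 'rV[R]_n => (gauss_tail n (enorm p.2) p.1)%:E).
Proof.
have m1 k : measurable_fun setT (fun p : 'rV[R]_m * 'rV[R]_n => enorm p.1 ^- k).
  by apply: (measurableT_comp (@measurable_enormV R m k)).
have m2 : measurable_fun setT (fun p : 'rV[R]_m * 'rV[R]_n => enorm p.2).
  by apply: (measurableT_comp (@measurable_enorm R n)).
suff H : measurable_fun setT (fun p : 'rV[R]_m * 'rV[R]_n => gauss_tail n (enorm p.2) p.1).
  exact: (iffRL (measurable_EFinP _ _) H).
apply: measurable_funM; first exact: m1.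
apply: measurableT_comp => //; apply: measurableT_comp => //.
apply: measurable_funX; apply: measurable_funM => //; exact: (m1 1%N).
Qed.

(* Every y G is |y| times a standard Gaussian vector. *)
Lemma gauss_mx_average m n : (0 < m < n)%N -> exists2 w : R, 0 < w &
  forall F : 'rV[R]_n -> \bar R, measurable_fun setT F -> (forall x, 0 <= F x)%E ->
  (\int[lebesgue_mx R n m]_G ((\int[lebesgue_rV R m]_y F (y *m G)) * (gauss_mx G)%:E) =
   w%:E * \int[lebesgue_rV R n]_x (F x * (enorm x ^- (n - m))%:E))%E.
Proof.
move=> mn; have /andP[m0 mn'] := mn; have n0 : (0 < n)%N by exact: leq_ltn_trans mn'.
have [w w0 Hw] := @integral_gauss_tail R m n mn.
pose q : R := Num.sqrt pi ^- n.
have q0 : 0 < q by rewrite invr_gt0 exprn_gt0// sqrtr_gt0 pi_gt0.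
exists (q * w) => [|F mF F0]; first exact: mulr_gt0.
have mFG : measurable_fun setT (fun p : 'M[R]_(m, n) * 'rV[R]_m =>
    F (p.2 *m p.1) * (gauss_mx p.1)%:E)%E.
  apply: emeasurable_funM; first by apply: measurableT_comp => //; apply: measurable_mulmx.
  by apply: (measurableT_comp (@measurable_gauss_mxE R n m)).
have FG0 (G : 'M[R]_(m, n)) (y : 'rV[R]_m) : (0 <= F (y *m G) * (gauss_mx G)%:E)%E.
  by rewrite mule_ge0// lee_fin gauss_mx_ge0.
transitivity (\int[lebesgue_mx R n m]_G \int[lebesgue_rV R m]_y
    (F (y *m G) * (gauss_mx G)%:E))%E.
  apply: eq_integral => G _; rewrite muleC -ge0_integralZl.
  - by apply: eq_integral => y _; rewrite muleC.
  - exact: measurableT.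
  - by apply: measurableT_comp => //; apply: measurable_mulmx.
  - by move=> y _; exact: F0.
  - by rewrite lee_fin gauss_mx_ge0.
rewrite (sigma_finite_fubini _ _ mFG FG0).
have mFz : measurable_fun setT (fun p : 'rV[R]_m * 'rV[R]_n =>
    F (enorm p.1 *: p.2) * (gauss_rV p.2)%:E)%E.
  apply: emeasurable_funM; last by apply: (measurableT_comp (@measurable_gauss_rVE R n)).
  apply: measurableT_comp => //; apply: measurable_scalemx => //.
  by apply: (measurableT_comp (@measurable_enorm R m)).
have Fz0 (y : 'rV[R]_m) (z : 'rV[R]_n) : (0 <= F (enorm y *: z) * (gauss_rV z)%:E)%E.
  by rewrite mule_ge0// lee_fin gauss_rV_ge0.
have mFt : measurable_fun setT (fun p : 'rV[R]_m * 'rV[R]_n =>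
    F p.2 * (q%:E * (gauss_tail n (enorm p.2) p.1)%:E))%E.
  apply: emeasurable_funM; first by apply: measurableT_comp.
  by apply: emeasurable_funM => //; exact: measurable_gauss_tail_pair.
have Ft0 (y : 'rV[R]_m) (x : 'rV[R]_n) :
    (0 <= F x * (q%:E * (gauss_tail n (enorm x) y)%:E))%E.
  by rewrite !mule_ge0// ?lee_fin ?gauss_tail_ge0// ltW.
transitivity (\int[lebesgue_rV R m]_y \int[lebesgue_rV R n]_z
    (F (enorm y *: z)%R * (gauss_rV z)%:E))%E.
  by apply: eq_integral => y _; rewrite integral_gauss_mx.
(* The substitution [x = |y| z] moves [|y|] from the argument of [F] into the density. After
   exchanging the integrals, [y] occurs only in [gauss_tail], whose integral at [t = |x|] is [w]
   times the desired weight. *)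
transitivity (\int[lebesgue_rV R m]_y \int[lebesgue_rV R n]_x
    (F x * (q%:E * (gauss_tail n (enorm x) y)%:E)))%E.
  apply: ge0_ae_eq_integral.
  - exact: measurableT.
  - exact: (measurable_fun_fubini_tonelli_F _ mFz).
  - exact: (measurable_fun_fubini_tonelli_F _ mFt).
  - by move=> y _; apply: integral_ge0 => z _; exact: Fz0.
  - by move=> y _; apply: integral_ge0 => z _; exact: Ft0.
  apply: ae_neq0_rV => // y y0 _.
  have y0' : 0 < enorm y by rewrite enorm_gt0.
  have mphi : measurable_fun setT (fun x : 'rV[R]_n =>
      F x * (gauss_rV ((enorm y)^-1 *: x))%:E)%E.
    apply: emeasurable_funM => //.
    by apply: (measurableT_comp (@measurable_gauss_rVE R n)); apply: measurable_scalemx.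
  have phi0 x : (0 <= F x * (gauss_rV ((enorm y)^-1 *: x))%:E)%E.
    by rewrite mule_ge0// lee_fin gauss_rV_ge0.
  have := lebesgue_rV_scale y0' mphi phi0.
  under eq_integral do rewrite scalerA mulVf ?gt_eqF// scale1r.
  move=> ->; rewrite -ge0_integralZl.
  - apply: eq_integral => x _.
    by rewrite muleCA -!EFinM gauss_rV_tail.
  - exact: measurableT.
  - exact: mphi.
  - by move=> x _; exact: phi0.
  - by rewrite lee_fin enormV_ge0.
rewrite (sigma_finite_fubini _ _ mFt Ft0).
rewrite -ge0_integralZl; last 4 first.
- exact: measurableT.
- by apply: emeasurable_funM => //; exact: measurable_enormVE.
- by move=> x _; rewrite mule_ge0// lee_fin enormV_ge0.
- by rewrite lee_fin mulr_ge0// ltW.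
apply: ge0_ae_eq_integral.
- exact: measurableT.
- exact: (measurable_fun_fubini_tonelli_G _ mFt).
- apply: emeasurable_funM => //.
  by apply: emeasurable_funM => //; exact: measurable_enormVE.
- by move=> x _; apply: integral_ge0 => y _; exact: Ft0.
- by move=> x _; rewrite !mule_ge0// lee_fin ?enormV_ge0// mulr_ge0// ltW.
apply: ae_neq0_rV => // x x0 _.
rewrite ge0_integralZl.
- rewrite ge0_integralZl.
  + by rewrite Hw ?enorm_gt0// -EFinM mulrA EFinM muleCA.
  + exact: measurableT.
  + exact: measurable_gauss_tailE.
  + by move=> y _; rewrite lee_fin gauss_tail_ge0.
  + by rewrite lee_fin ltW.
- exact: measurableT.
- by apply: emeasurable_funM => //; exact: measurable_gauss_tailE.
- by move=> y _; rewrite mule_ge0// lee_fin ?gauss_tail_ge0// ltW.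
- exact: F0.
Qed.

Lemma pid_mx_orthonormal m n : (m <= n)%N ->
  (pid_mx m : 'M[R]_(m, n)) *m (pid_mx m)^T = 1%:M.
Proof.
move=> mn; rewrite tr_pid_mx mul_pid_mx minnn (minn_idPr mn).
exact: pid_mx_1.
Qed.

(** The hypothesis is averaged over Gaussian [G], and the same [w] appears on both sides. A matrix
    that is not row free has [det (G J^T) = 0] for [J = pid_mx m], so the exceptions form a null
    set. *)
Lemma section_le_riesz m n M (F g : 'rV[R]_n -> \bar R) : (0 < m < n)%N -> 0 <= M ->
  measurable_fun setT F -> (forall x, 0 <= F x)%E ->
  measurable_fun setT g -> (forall x, 0 <= g x)%E ->
  (forall G : 'M[R]_(m, n), row_free G ->
    \int[lebesgue_rV R m]_y F (y *m G) <= M%:E * \int[lebesgue_rV R m]_y g (y *m G))%E ->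
  (\int[lebesgue_rV R n]_x (F x * (enorm x ^- (n - m))%:E) <=
   M%:E * \int[lebesgue_rV R n]_x (g x * (enorm x ^- (n - m))%:E))%E.
Proof.
move=> mn M0 mF F0 mg g0 FMg.
have [w w0 Hw] := gauss_mx_average mn.
have ww : w%:E \is a fin_num by [].
rewrite -(@lee_pmul2l _ w%:E)//.
rewrite muleCA -!Hw//.
have ms (h : 'rV[R]_n -> \bar R) : measurable_fun setT h -> (forall x, 0 <= h x)%E ->
    measurable_fun setT (fun G : 'M[R]_(m, n) =>
      (\int[lebesgue_rV R m]_y h (y *m G)) * (gauss_mx G)%:E)%E.
  move=> mh h0; apply: emeasurable_funM; last exact: measurable_gauss_mxE.
  apply: (measurable_fun_fubini_tonelli_F (fun p : 'M[R]_(m, n) * 'rV[R]_m => h (p.2 *m p.1))).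
    by apply: measurableT_comp => //; apply: measurable_mulmx.
  by move=> p; exact: h0.
have s0 (h : 'rV[R]_n -> \bar R) (G : 'M[R]_(m, n)) : (forall x, 0 <= h x)%E ->
    (0 <= (\int[lebesgue_rV R m]_y h (y *m G)) * (gauss_mx G)%:E)%E.
  by move=> h0; rewrite mule_ge0 ?lee_fin ?gauss_mx_ge0// integral_ge0.
rewrite -ge0_integralZl; last 4 first.
- exact: measurableT.
- exact: ms.
- by move=> G _; exact: s0.
- by rewrite lee_fin.
apply: ae_ge0_le_integral.
- exact: measurableT.
- by move=> G _; exact: s0.
- exact: ms.
- by move=> G _; rewrite mule_ge0 ?lee_fin// s0.
- by apply: emeasurable_funM => //; exact: ms.
have /andP[_ /ltnW mn'] := mn.
have JJ := pid_mx_orthonormal mn'.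
have [mD D0] := degenerate_mx_null JJ.
exists [set G | \det (G *m (pid_mx m)^T) = 0]; split=> // G /= nH.
apply: contrapT => detG; apply: nH => _.
rewrite muleA lee_wpmul2r ?lee_fin ?gauss_mx_ge0//; apply: FMg.
have uG : G *m (pid_mx m)^T \in unitmx by rewrite unitmxE unitfE; apply/eqP.
rewrite -row_leq_rank -{1}(mxrank_unit uG); exact: mxrankM_maxl.
Qed.

(** Inside the ball of radius [r], [g <= 1] leaves the integral of the weight, which gives the
    [2 ^+ k.+1]. Outside, the weight is at most [r ^- k], and [r ^- k * I = r ^+ (n - k) * omega n]
    by the choice of [r], which gives the [+ 1]. *)
Lemma integral_riesz_le n k (g : 'rV[R]_n -> \bar R) (I : R) : (0 < k < n)%N ->
  measurable_fun setT g -> (forall x, 0 <= g x)%E -> (forall x, g x <= 1)%E ->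
  (\int[lebesgue_rV R n]_x g x = I%:E)%E -> 0 < I ->
  (\int[lebesgue_rV R n]_x (g x * (enorm x ^- k)%:E) <=
   ((2 ^+ k.+1 + 1) * (I `^ ((n - k)%:R / n%:R) * omega n `^ (k%:R / n%:R)))%:E)%E.
Proof.
move=> kn mg g0 g1 gI I0; have /andP[k0 kn'] := kn.
have n0 : (0 < n)%N by exact: leq_ltn_trans kn'.
have nn0 : n%:R != 0 :> R by rewrite pnatr_eq0 -lt0n.
have o0 := omega_gt0 R n.
pose r : R := (I / omega n) `^ n%:R^-1.
have r0 : 0 < r by rewrite powR_gt0// divr_gt0.
have rn : r ^+ n * omega n = I.
  rewrite -powR_mulrn ?ltW// -powRrM mulVf// powRr1; last by rewrite divr_ge0// ltW.
  by rewrite divfK// gt_eqF.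
have rk : r ^+ (n - k) * omega n = I `^ ((n - k)%:R / n%:R) * omega n `^ (k%:R / n%:R).
  rewrite -powR_mulrn ?ltW// -powRrM [_^-1 * _]mulrC powRM ?invr_ge0 ?ltW//.
  rewrite -mulrA; congr (_ * _).
  rewrite -powR_inv1 ?ltW// -powRrM -{2}[omega n]powRr1 ?ltW// -powRD.
    congr (_ `^ _); rewrite natrB; last exact: ltnW.
    by move: (n%:R : R) (k%:R : R) nn0 => u v u0; field.
  by apply/implyP => _; rewrite gt_eqF.
have m1 : measurable_fun setT (fun y : 'rV[R]_n => (\1_(eball r) y : R)%:E).
  by apply/measurable_EFinP; apply: measurable_indic; exact: measurable_eball.
have me : measurable_fun setT (fun x : 'rV[R]_n => (\1_(eball r) x)%:E * (enorm x ^- k)%:E)%E.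
  by apply: emeasurable_funM => //; exact: measurable_enormVE.
have e0 x : (0 <= (\1_(@eball R n r) x)%:E * (enorm x ^- k)%:E)%E.
  by rewrite mule_ge0// lee_fin// enormV_ge0.
apply: (@le_trans _ _ (\int[lebesgue_rV R n]_x ((\1_(eball r) x)%:E * (enorm x ^- k)%:E +
    (r ^- k)%:E * g x))%E).
  apply: ge0_le_integral => //.
  - by move=> x _; rewrite mule_ge0// lee_fin enormV_ge0.
  - by apply: emeasurable_funM => //; exact: measurable_enormVE.
  - by apply: emeasurable_funD => //; exact: emeasurable_funM.
  move=> x _; have [xr|xr] := boolP (x \in eball r).
    rewrite indicE xr mul1e -[leLHS]adde0; apply: leeD.
      by rewrite -[leRHS]mul1e lee_wpmul2r// lee_fin enormV_ge0.
    by rewrite mule_ge0// lee_fin invr_ge0 exprn_ge0// ltW.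
  rewrite indicE (negbTE xr) mul0e add0e muleC lee_wpmul2r//.
  have {}xr : r < enorm x by move: xr; rewrite notin_setE /eball/= => /negP; rewrite -ltNge.
  have x0 : 0 < enorm x by exact: lt_trans xr.
  rewrite lee_fin lef_pV2 ?posrE ?exprn_gt0//.
  by apply: lerXn2r; rewrite ?nnegrE ltW.
rewrite ge0_integralD; last 5 first.
- exact: measurableT.
- by move=> x _; exact: e0.
- exact: me.
- by move=> x _; rewrite mule_ge0// lee_fin invr_ge0 exprn_ge0// ltW.
- exact: emeasurable_funM.
rewrite ge0_integralZl//; last by rewrite lee_fin invr_ge0 exprn_ge0// ltW.
have -> : ((2 ^+ k.+1 + 1) * (I `^ ((n - k)%:R / n%:R) * omega n `^ (k%:R / n%:R)) =
   2 * (2 ^+ k * r ^+ (n - k)) * omega n + r ^- k * I).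
  have -> : r ^- k * I = r ^+ (n - k) * omega n.
    rewrite -rn; have -> : r ^+ n = r ^+ k * r ^+ (n - k) by rewrite -exprD subnKC// ltnW.
    rewrite !mulrA mulVf ?mul1r//.
    by rewrite expf_neq0// gt_eqF.
  by rewrite -rk exprS; ring.
by rewrite EFinD gI -EFinM leeD2r// integral_enormV_ball.
Qed.

(** Equality at [k = 1] is the origin of the constant 5; each further step multiplies the right side
    by 5 and the power on the left only by 2. *)
Lemma exp2_add1_le_exp5 k : (0 < k)%N -> 2 ^+ k.+1 + 1 <= 5 ^+ k :> R.
Proof.
case: k => // k _; elim: k => [|k IH]; first by rewrite expr1 expr2; lra.
rewrite exprS [leRHS]exprS.
have : (0 : R) <= 2 ^+ k.+2 by rewrite exprn_ge0.
by move: IH; set u := _ ^+ _; set v := _ ^+ _; lra.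
Qed.

Lemma section_bound_ball m n M (F g : 'rV[R]_n -> \bar R) (I : R) :
  (0 < m < n)%N -> 0 <= M ->
  measurable_fun setT F -> (forall x, 0 <= F x)%E ->
  (forall x, ~ euclidean_ball x -> F x = 0)%E ->
  measurable_fun setT g -> (forall x, 0 <= g x)%E -> (forall x, g x <= 1)%E ->
  (\int[lebesgue_rV R n]_x g x = I%:E)%E -> 0 < I ->
  (forall G : 'M[R]_(m, n), row_free G ->
    \int[lebesgue_rV R m]_y F (y *m G) <= M%:E * \int[lebesgue_rV R m]_y g (y *m G))%E ->
  (\int[lebesgue_rV R n]_x F x <=
   (M * (5 ^+ (n - m) * (I `^ (m%:R / n%:R) * omega n `^ ((n - m)%:R / n%:R))))%:E)%E.
Proof.
move=> mn M0 mF F0 FB mg g0 g1 gI I0 FMg; have /andP[m0 mn'] := mn.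
have n0 : (0 < n)%N by exact: leq_ltn_trans mn'.
have kn : (0 < n - m < n)%N by rewrite subn_gt0 mn' ltn_subrL m0.
apply: (@le_trans _ _ (\int[lebesgue_rV R n]_x (F x * (enorm x ^- (n - m))%:E))%E).
  apply: ae_ge0_le_integral => //.
  - by move=> x _; rewrite mule_ge0// lee_fin enormV_ge0.
  - by apply: emeasurable_funM => //; exact: measurable_enormVE.
  apply: ae_neq0_rV => // x x0 _.
  have [xB|/FB ->] := pselect (euclidean_ball x); last by rewrite mul0e.
  rewrite -[leLHS]mule1 lee_wpmul2l// lee_fin.
  have x1 : enorm x <= 1 by move: xB; rewrite euclidean_ballE.
  by rewrite invf_ge1 ?exprn_gt0 ?enorm_gt0// exprn_ile1// enorm_ge0.
apply: le_trans (section_le_riesz mn M0 mF F0 mg g0 FMg) _.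
rewrite EFinM; apply: lee_wpmul2l; first by rewrite lee_fin.
apply: le_trans (integral_riesz_le kn mg g0 g1 gI I0) _.
rewrite lee_fin subKn; last exact: ltnW.
apply: ler_wpM2r; first by apply: mulr_ge0; exact: powR_ge0.
by apply: exp2_add1_le_exp5; rewrite subn_gt0.
Qed.

End average.

(** * Ellipsoids in place of the unit ball *)

Section ellipsoid.
Variable R : realType.
Implicit Types (m n k : nat) (M : R).

Lemma measurable_ellipsoid n (A : 'M[R]_n) : A \in unitmx ->
  measurable [set x *m A | x in @euclidean_ball R n].
Proof.
move=> uA; set E := [set _ | _ in _].
have mV : measurable_fun setT (fun x : 'rV[R]_n => x *m invmx A) by exact: measurable_mulmxr.
rewrite (_ : E = setT `&` (fun x : 'rV[R]_n => x *m invmx A) @^-1` (@euclidean_ball R n)).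
  by apply: mV => //; rewrite euclidean_ballE; exact: measurable_eball.
rewrite setTI; apply/seteqP; split=> [_ [x Bx <-]|x Bx]; first by rewrite /= mulmxK.
by exists (x *m invmx A) => //; rewrite mulmxKV.
Qed.

(** The indicator of the ellipsoid pulls back to that of the unit ball, so that [omega n] is [c]
    times the volume sought; [c] stands for [|det A|^-1]. *)
Lemma lebesgue_ellipsoid n (A : 'M[R]_n) (c : R) : A \in unitmx -> 0 < c ->
  (forall phi : 'rV[R]_n -> \bar R, measurable_fun setT phi -> (forall x, 0 <= phi x) ->
    \int[lebesgue_rV R n]_x phi (x *m A) = c%:E * \int[lebesgue_rV R n]_x phi x)%E ->
  lebesgue_rV R n [set x *m A | x in @euclidean_ball R n] = (omega n / c)%:E.
Proof.
move=> uA c0 Hc; have mE := measurable_ellipsoid uA; set E := [set _ | _ in _] in mE *.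
have m1 : measurable_fun setT (fun y : 'rV[R]_n => (\1_E y : R)%:E).
  by apply/measurable_EFinP; apply: measurable_indic.
have m10 x : (0 <= (\1_E x : R)%:E)%E by rewrite lee_fin.
have H := Hc _ m1 m10.
have cV : c^-1 * c = 1 by rewrite mulVf// gt_eqF.
rewrite -[LHS]mul1e -[X in (X * _)%E]/(1%:E) -cV EFinM -muleA.
have -> : lebesgue_rV R n E = (\int[lebesgue_rV R n]_x (\1_E x)%:E)%E.
  by rewrite integral_indic// setIT.
rewrite -H (_ : (fun _ => _) = fun x => (\1_(@eball R n 1) x : R)%:E).
  by rewrite integral_eball// expr1n mul1r -EFinM mulrC.
apply/funext => x; rewrite !indicE.
suff -> : (x *m A \in E) = (x \in @eball R n 1) by [].
apply/idP/idP; rewrite !inE -euclidean_ballE; last by move=> Bx; exists x.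
by move=> [y By /(can_inj (mulmxK uA)) <-].
Qed.

(** The ball case is applied to [F (x A)] and [g (x A)]; the hypothesis carries over because [G A]
    is row free whenever [G] is. The integrals of [F] and [g] are multiplied by [c], and
    [omega n = c * v]. As the exponents [m / n] and [(n - m) / n] add up to 1, both sides carry
    exactly one factor [c]. *)
Lemma section_bound_ellipsoid m n M (A : 'M[R]_n) (F g : 'rV[R]_n -> \bar R) (I : R) :
  (0 < m < n)%N -> 0 <= M -> A \in unitmx ->
  measurable_fun setT F -> (forall x, 0 <= F x)%E ->
  (forall x, ~ [set x *m A | x in @euclidean_ball R n] x -> F x = 0)%E ->
  measurable_fun setT g -> (forall x, 0 <= g x)%E -> (forall x, g x <= 1)%E ->
  (\int[lebesgue_rV R n]_x g x = I%:E)%E -> 0 < I ->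
  (forall G : 'M[R]_(m, n), row_free G ->
    \int[lebesgue_rV R m]_y F (y *m G) <= M%:E * \int[lebesgue_rV R m]_y g (y *m G))%E ->
  exists2 v : R, 0 < v &
    lebesgue_rV R n [set x *m A | x in @euclidean_ball R n] = v%:E /\
  (\int[lebesgue_rV R n]_x F x <=
   (M * (5 ^+ (n - m) * (I `^ (m%:R / n%:R) * v `^ ((n - m)%:R / n%:R))))%:E)%E.
Proof.
move=> mn M0 uA mF F0 FE mg g0 g1 gI I0 FMg; have /andP[m0 mn'] := mn.
have n0 : (0 < n)%N by exact: leq_ltn_trans mn'.
have nn0 : n%:R != 0 :> R by rewrite pnatr_eq0 -lt0n.
have [c c0 Hc] := lebesgue_rV_linear uA.
have o0 := omega_gt0 R n.
have mA : measurable_fun setT (fun x : 'rV[R]_n => x *m A) by exact: measurable_mulmxr.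
exists (omega n / c); first by rewrite divr_gt0.
split; first exact: lebesgue_ellipsoid.
have FAB x : ~ euclidean_ball x -> F (x *m A) = 0%E.
  by move=> nBx; apply: FE => -[y By /(can_inj (mulmxK uA)) yx]; apply: nBx; rewrite -yx.
have gAI : (\int[lebesgue_rV R n]_x g (x *m A) = (c * I)%:E)%E by rewrite Hc// gI EFinM.
have FGA (G : 'M[R]_(m, n)) : row_free G ->
    (\int[lebesgue_rV R m]_y F (y *m G *m A) <=
     M%:E * \int[lebesgue_rV R m]_y g (y *m G *m A))%E.
  move=> fG; have fGA : row_free (G *m A).
    by rewrite -row_leq_rank mxrankMfree ?row_leq_rank// row_free_unit.
  have assoc h : (\int[lebesgue_rV R m]_y h (y *m G *m A) =
      \int[lebesgue_rV R m]_y h (y *m (G *m A)) :> \bar R)%E.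
    by apply: eq_integral => y _; rewrite mulmxA.
  by rewrite !assoc; exact: FMg.
have := section_bound_ball mn M0 (measurableT_comp mF mA) (fun x => F0 _) FAB
  (measurableT_comp mg mA) (fun x => g0 _) (fun x => g1 _) gAI (mulr_gt0 c0 I0) FGA.
set a : R := m%:R / n%:R; set b : R := (n - m)%:R / n%:R.
have ab : a + b = 1 by rewrite /a /b -mulrDl natrB 1?ltnW// addrC subrK mulfV.
have -> : (c * I) `^ a * omega n `^ b = c * (I `^ a * (omega n / c) `^ b).
  have c00 : 0 <= c by exact: ltW.
  have I00 : 0 <= I by exact: ltW.
  have o00 : 0 <= omega n :> R by exact: ltW.
  rewrite (powRM _ c00 I00) (powRM _ o00); last by rewrite invr_ge0.
  have cb : c `^ b != 0 by rewrite gt_eqF// powR_gt0.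
  have -> : c^-1 `^ b = (c `^ b)^-1 by rewrite -powR_inv1// -powRrM mulN1r powRN.
  have -> : c `^ a = c / c `^ b.
    apply: (mulIf cb); rewrite divfK// -powRD; first by rewrite ab powRr1.
    by apply/implyP => _; rewrite gt_eqF.
  by ring.
rewrite /= Hc//; set Z := I `^ a * _; set p : R := 5 ^+ _.
by rewrite (_ : M * (p * (c * Z)) = c * (M * (p * Z))) 1?EFinM ?lee_pmul2l//; ring.
Qed.

End ellipsoid.

(** * Sections by subspaces *)

Section subspaces_and_bounds.
Variable R : realType.
Implicit Types (m n k : nat).

Lemma memv_onframe n (H : {vspace 'rV[R]_n}) (y : 'rV[R]_(\dim H)) :
  y *m onframe H \in H.
Proof. by have [_ HH] := onframeP H; apply/HH; exists y. Qed.

Lemma measurable_vspace n (H : {vspace 'rV[R]_n}) :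
  measurable [set x : 'rV[R]_n | x \in H].
Proof.
have [PP HP] := onframeP H; set P := onframe H in PP HP.
(* [P^T *m P] is the orthogonal projection onto [H], so [H] is the zero set of the complementary
   projection. *)
rewrite (_ : [set x | _] = setT `&` (fun x : 'rV[R]_n => sqn (x *m (1%:M - P^T *m P))) @^-1` [set 0]).
  have : measurable_fun setT (fun x : 'rV[R]_n => sqn (x *m (1%:M - P^T *m P))).
    by apply: (measurableT_comp (@measurable_sqn R n)); exact: measurable_mulmxr.
  by apply.
rewrite setTI; apply/seteqP; split => [x /= /HP[y ->]|x /= /eqP].
  rewrite mulmxBr mulmx1 mulmxA -(mulmxA y) PP mulmx1 subrr.
  by apply/eqP; rewrite sqn_eq0.
rewrite sqn_eq0 mulmxBr mulmx1 subr_eq0 => /eqP ->.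
by apply/HP; exists (x *m P^T); rewrite mulmxA.
Qed.

Lemma integral_lebesgue_vspace n (H : {vspace 'rV[R]_n}) (D : set 'rV[R]_n)
    (h : 'rV[R]_n -> \bar R) :
  measurable D -> measurable_fun D h -> (forall x, D x -> 0 <= h x)%E ->
  (\int[lebesgue_vspace H]_(x in D `&` [set x | x \in H]) h x =
   \int[lebesgue_rV R (\dim H)]_y (h \_ D) (y *m onframe H))%E.
Proof.
move=> mD mh h0.
have mDH : measurable (D `&` [set x | x \in H]).
  by apply: measurableI => //; exact: measurable_vspace.
rewrite (@ge0_integral_pushforward _ _ _ _ R _ (measurable_mulmxr (onframe H)) _ _ h mDH); last 2 first.
- by apply: measurable_funS mh => // x [].
- by move=> x; rewrite inE => -[Dx _]; exact: h0.
rewrite integral_mkcond; apply: eq_integral => y _; rewrite !patchE/=.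
suff -> : (y \in (fun y => y *m onframe H) @^-1` (D `&` [set x | x \in H])) =
  (y *m onframe H \in D) by [].
apply/idP/idP; rewrite !inE /=; first by case.
by move=> Dy; split => //; exact: memv_onframe.
Qed.

(** [G = T P] with [T = G P^T] square and invertible, and [c] is the factor of the change of
    variables [T]. The equation [d = m] is a hypothesis because [d] will be [\dim H], which is equal
    to [m] only by a proof. *)
Lemma integral_mulmx_frame m n d (G : 'M[R]_(m, n)) (P : 'M[R]_(d, n)) :
  d = m -> row_free G -> P *m P^T = 1%:M ->
  (forall y : 'rV_m, exists z : 'rV_d, y *m G = z *m P) ->
  exists2 c : R, 0 < c & forall h : 'rV[R]_n -> \bar R,
    measurable_fun setT h -> (forall x, 0 <= h x)%E ->
    (\int[lebesgue_rV R m]_y h (y *m G) = c%:E * \int[lebesgue_rV R d]_y h (y *m P))%E.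
Proof.
move=> dm; subst d => fG PP GP.
have GTP : G = G *m P^T *m P.
  apply/row_matrixP => i; have [z Gz] := GP (delta_mx 0 i).
  by rewrite !row_mul rowE Gz -(mulmxA z) PP mulmx1.
have uT : G *m P^T \in unitmx.
  rewrite -row_free_unit -row_leq_rank; move: fG; rewrite -row_leq_rank => /leq_trans; apply.
  by rewrite {1}GTP mxrankM_maxl.
have [c c0 Hc] := lebesgue_rV_linear uT.
exists c => // h mh h0.
have mhP : measurable_fun setT (fun y : 'rV[R]_m => h (y *m P)).
  by apply: measurableT_comp => //; exact: measurable_mulmxr.
rewrite -(Hc (fun y => h (y *m P)))//.
by apply: eq_integral => y _; rewrite -!mulmxA (mulmxA G) -GTP.
Qed.

Lemma row_free_vspace m n (G : 'M[R]_(m, n)) : row_free G ->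
  exists H : {vspace 'rV[R]_n}, \dim H = m /\
    forall x, x \in H <-> exists y : 'rV_m, x = y *m G.
Proof.
move=> fG; pose f : 'Hom('rV[R]_m, 'rV[R]_n) := linfun (mulmxr G).
have fE y : f y = y *m G by rewrite lfunE.
exists (f @: fullv)%VS; split.
  rewrite limg_dim_eq ?dimvf/= ?mul1n//.
    by rewrite /dim/= mul1n.
  apply/eqP; rewrite -subv0; apply/subvP => y /memv_capP[_].
  rewrite memv_ker fE memv0 => /eqP yG.
  by apply/eqP; apply: (row_free_inj fG); rewrite yG mul0mx.
move=> x; split => [/memv_imgP[y _ ->]|[y ->]]; first by exists y; rewrite fE.
by rewrite -fE memv_img// memvf.
Qed.

(* The same factor for all integrands, so that it cancels in quotients. *)
Lemma row_free_section m n (G : 'M[R]_(m, n)) : row_free G ->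
  exists2 H : {vspace 'rV[R]_n}, \dim H = m & exists2 c : R, 0 < c &
  forall h : 'rV[R]_n -> \bar R, measurable_fun setT h -> (forall x, 0 <= h x)%E ->
    (\int[lebesgue_rV R m]_y h (y *m G) =
     c%:E * \int[lebesgue_rV R (\dim H)]_y h (y *m onframe H))%E.
Proof.
move=> fG; have [H [dH GH]] := row_free_vspace fG; exists H => //.
have [PP HP] := onframeP H.
apply: integral_mulmx_frame => // y.
by apply/HP; apply/GH; exists y.
Qed.

Lemma ler_coord_norm n (x : 'rV[R]_n) i : `|x 0 i| <= `|x|.
Proof.
rewrite [leRHS]/Num.norm/= mx_normrE.
exact: (le_bigmax _ (fun ij : 'I_1 * 'I_n => `|x ij.1 ij.2|) (ord0, i)).
Qed.

Lemma bounded_set_cube n (K : set 'rV[R]_n) : bounded_set K ->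
  exists2 r : R, 0 < r & K `<=` cube r.
Proof.
move=> [M [_ HM]]; exists (`|M| + 1); first by rewrite ltr_wpDl.
move=> x Kx i; rewrite in_itv/= -ler_norml.
apply: le_trans (ler_coord_norm x i) _; apply: (HM (`|M| + 1)) => //.
by rewrite ltr_pwDr// ler_norm.
Qed.

Lemma bounded_set_lty n (K : set 'rV[R]_n) : measurable K -> bounded_set K ->
  (lebesgue_rV R n K < +oo)%E.
Proof.
move=> mK /bounded_set_cube[r r0 Kr].
apply: (@le_lt_trans _ _ (lebesgue_rV R n (cube r))).
  apply: (@le_measure _ _ _ (lebesgue_rV R n)) => //; rewrite inE//.
  exact: measurable_cube.
by rewrite (lebesgue_cube n (ltW r0)) ltry.
Qed.

Lemma bounded_set_ellipsoid n (K : set 'rV[R]_n) : bounded_set K ->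
  exists2 A : 'M[R]_n, A \in unitmx & K `<=` [set x *m A | x in @euclidean_ball R n].
Proof.
move=> /bounded_set_cube[r r0 Kr].
(* The cube of half-side [1 / (n + 1)] lies in the unit ball; dilated by [s], it becomes the cube of
   half-side [r]. *)
pose s := n.+1%:R * r.
have s0 : 0 < s by rewrite mulr_gt0.
exists s%:M; first by rewrite unitmxE det_scalar unitfE expf_neq0// gt_eqF.
move=> x Kx; exists (s^-1 *: x); last first.
  by rewrite mul_mx_scalar scalerA mulfV ?scale1r// gt_eqF.
rewrite euclidean_ballE; apply: cube_eball.
rewrite cube_scale ?invr_gt0// invrK /s mulrA mulVf ?mul1r//.
exact: Kr.
Qed.

(** For [b = 0] the quotient is [+oo] unless [a = 0]. For [b = +oo] the quotient is 0, and
    positivity of [M] makes the product [+oo]; with [M = 0] it would be 0. *)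
Lemma lee_div_mul (a b : \bar R) (M : R) : (0 <= a)%E -> (0 <= b)%E -> 0 < M ->
  (a / b <= M%:E)%E -> (a <= M%:E * b)%E.
Proof.
move=> a0 b0 M0; case: b b0 => [b| |//]; last by rewrite gt0_muley ?lte_fin ?leey.
rewrite lee_fin le_eqVlt => /orP[/eqP <-|b0].
  rewrite inver eqxx mule0; move: a0; rewrite le_eqVlt => /orP[/eqP <-//|a0].
  by rewrite gt0_muley.
by rewrite inver gt_eqF// lee_pdivrMr.
Qed.

End subspaces_and_bounds.

(** * From functions and matrices to sets, subspaces and the outer volume ratio *)

Section sets.
Variable R : realType.
Implicit Types (m n k : nat) (M : R).

(** Extension by zero turns integrals over [K] and [L] into integrals over the whole space. For a
    row free [G], the quotient bound on its row space becomes a product bound, and the common factor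
    [c] of both integrals gives it the matrix form of [section_bound_ellipsoid]. *)
Lemma section_bound_set m n M (K L : set 'rV[R]_n) (f g : 'rV[R]_n -> R) (A : 'M[R]_n) (I : R) :
  (0 < m < n)%N -> 0 < M -> A \in unitmx ->
  measurable K -> measurable_fun K f -> (forall x, K x -> 0 <= f x) ->
  measurable L -> measurable_fun L g -> (forall x, L x -> 0 <= g x) ->
  (forall x, L x -> g x <= 1) ->
  (\int[lebesgue_rV R n]_(x in L) (g x)%:E = I%:E)%E -> 0 < I ->
  K `<=` [set x *m A | x in @euclidean_ball R n] ->
  (forall H : {vspace 'rV[R]_n}, \dim H = m ->
    (\int[lebesgue_vspace H]_(x in K `&` [set x | x \in H]) (f x)%:E) /
    (\int[lebesgue_vspace H]_(x in L `&` [set x | x \in H]) (g x)%:E) <= M%:E)%E ->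
  exists2 v : R, 0 < v &
    lebesgue_rV R n [set x *m A | x in @euclidean_ball R n] = v%:E /\
  (\int[lebesgue_rV R n]_(x in K) (f x)%:E <=
   (M * (5 ^+ (n - m) * (I `^ (m%:R / n%:R) * v `^ ((n - m)%:R / n%:R))))%:E)%E.
Proof.
move=> mn M0 uA mK mf f0 mL mg g0 g1 gI I0 KE HM.
have mfE : measurable_fun K (EFin \o f) by apply/measurable_EFinP.
have mgE : measurable_fun L (EFin \o g) by apply/measurable_EFinP.
have f0E x : K x -> (0 <= (EFin \o f) x)%E by move=> Kx; rewrite lee_fin f0.
have g0E x : L x -> (0 <= (EFin \o g) x)%E by move=> Lx; rewrite lee_fin g0.
have mF := (measurable_restrictT (EFin \o f) mK).1 mfE.
have mG := (measurable_restrictT (EFin \o g) mL).1 mgE.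
have F0 := erestrict_ge0 f0E.
have G0 := erestrict_ge0 g0E.
rewrite integral_mkcond; rewrite integral_mkcond in gI.
apply: (@section_bound_ellipsoid R m n M A _ ((EFin \o g) \_ L)) => //.
- exact: ltW.
- by move=> x nEx; rewrite patchE memNset// => /KE.
- move=> x; rewrite patchE; case: ifPn => //; rewrite inE => Lx.
  by rewrite lee_fin g1.
move=> G fG; have [H dH [c c0 Hc]] := row_free_section fG.
rewrite !Hc//.
have := HM H dH; rewrite !integral_lebesgue_vspace// => /lee_div_mul Hab.
rewrite muleCA lee_pmul2l//; apply: Hab => //.
- by apply: integral_ge0 => y _; exact: F0.
- by apply: integral_ge0 => y _; exact: G0.
Qed.

(** Solving for [t] shows that the [k]-th root of [q / c] is a lower bound of [T], hence at most
    [o]. The last hypothesis says that [o] is at least every lower bound, as an infimum is even when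
    it is not attained. *)
Lemma le_mul_exprn_inf k (q c o : R) (T : set R) : (0 < k)%N -> 0 <= q -> 0 < c ->
  (forall t, T t -> 0 <= t) -> (forall t, T t -> q <= c * t ^+ k) ->
  (forall r, (forall t, T t -> r <= t) -> r <= o) -> q <= c * o ^+ k.
Proof.
move=> k0 q0 c0 T0 qT oT.
have kk : k%:R != 0 :> R by rewrite pnatr_eq0 -lt0n.
pose r := (q / c) `^ k%:R^-1.
have qc0 : 0 <= q / c by rewrite divr_ge0// ltW.
have rk : r ^+ k = q / c.
  by rewrite -powR_mulrn ?powR_ge0// -powRrM mulVf// powRr1.
have ro : r <= o.
  apply: oT => t Tt; have t0 := T0 _ Tt.
  have : r ^+ k <= t ^+ k by rewrite rk ler_pdivrMr// mulrC qT.
  by rewrite ler_pXn2r// nnegrE ?powR_ge0.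
rewrite mulrC -ler_pdivrMr// -rk lerXn2r// nnegrE ?powR_ge0//.
exact: le_trans (powR_ge0 _ _) ro.
Qed.

Lemma sup_norm_le1 (T : Type) (L : set T) (g : T -> R) : sup [set `|g x| | x in L] = 1 ->
  forall x, L x -> g x <= 1.
Proof.
move=> g1 x Lx; apply: le_trans (ler_norm _) _; rewrite -g1.
apply: ub_le_sup; last by exists x.
(* A set without a supremum would give [sup] its default value 0, not 1. *)
have [//|/sup_out g_0] := pselect (has_sup [set `|g x| | x in L]).
  by case.
by move: g1; rewrite g_0 => /esym/eqP; rewrite oner_eq0.
Qed.

End sets.

(* Extended-real division follows x / 0 = x * +oo, i.e. a / 0 = +oo if a > 0 and
   0 / 0 = 0. *)
Theorem theorem2 (R : realType) :
  exists C : R, 0 < C /\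
  forall (n : nat), (2 <= n)%N ->
  forall (K L : set 'rV[R]_n),
    measurable K -> bounded_set K ->
    measurable L -> bounded_set L ->
    (0 < lebesgue_rV R n K)%E ->
  forall (f g : 'rV[R]_n -> R),
    measurable_fun K f -> [bounded f x | x in K] ->
    (forall x, K x -> 0 <= f x) ->
    measurable_fun L g -> [bounded g x | x in L] ->
    (forall x, L x -> 0 <= g x) ->
    (0 < \int[lebesgue_rV R n]_(x in L) (g x)%:E)%E ->
    sup [set `|g x| | x in L] = 1 ->
  forall (k : nat), (1 <= k <= n - 1)%N ->
    ((\int[lebesgue_rV R n]_(x in K) (f x)%:E) /
       ((\int[lebesgue_rV R n]_(x in L) (g x)%:E) `^ ((n - k)%N%:R / n%:R)%R *
        (lebesgue_rV R n K) `^ (k%:R / n%:R)%R)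
     <= (C%:E * ovr K) ^+ k *
        ereal_sup
          [set (\int[lebesgue_vspace H]_(x in K `&` [set x | x \in H]) (f x)%:E) /
               (\int[lebesgue_vspace H]_(x in L `&` [set x | x \in H]) (g x)%:E)
          | H in @Gr R n (n - k)%N])%E.
Proof.
exists 5; split => // n n2 K L mK bK mL bL K0 f g mf _ f0 mg _ g0 I0 g1 k /andP[k1 kn].
have n0 : (0 < n)%N by exact: ltnW.
have {}kn : (k < n)%N by rewrite (leq_ltn_trans kn)// subn1 prednK.
have mn : (0 < n - k < n)%N by rewrite subn_gt0 kn ltn_subrL k1.
have kE : (n - (n - k) = k)%N by rewrite subKn// ltnW.
have {}g1 := sup_norm_le1 g1.
have [kap KE] : exists kap : R, lebesgue_rV R n K = kap%:E.
  exists (fine (lebesgue_rV R n K)); rewrite fineK// ge0_fin_numE ?ltW//.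
  exact: bounded_set_lty.
have kap0 : 0 < kap by move: K0; rewrite KE lte_fin.
have [I IE] : exists I : R, (\int[lebesgue_rV R n]_(x in L) (g x)%:E = I%:E)%E.
  exists (fine (\int[lebesgue_rV R n]_(x in L) (g x)%:E)%E).
  rewrite fineK// ge0_fin_numE ?ltW//.
  apply: (@le_lt_trans _ _ (\int[lebesgue_rV R n]_(x in L) cst 1 x)%E).
    by apply: ge0_le_integral => //; exact/measurable_EFinP.
  by rewrite integral_cst// mul1e; exact: bounded_set_lty.
have {}I0 : 0 < I by move: I0; rewrite IE lte_fin.
set S := ereal_sup _.
have HS (H : {vspace 'rV[R]_n}) : \dim H = (n - k)%N ->
    ((\int[lebesgue_vspace H]_(x in K `&` [set x | x \in H]) (f x)%:E) /
     (\int[lebesgue_vspace H]_(x in L `&` [set x | x \in H]) (g x)%:E) <= S)%E.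
  by move=> dH; apply: ereal_sup_ubound; exists H.
(* The supremum of the empty set is [-oo], so an actual subspace is required: the span of the first
   [n - k] coordinate vectors. *)
have S0 : (0 <= S)%E.
  have fJ : row_free (pid_mx (n - k) : 'M[R]_(n - k, n)).
    by apply/row_freeP; exists (pid_mx (n - k))^T; rewrite pid_mx_orthonormal// leq_subr.
  have [H [dH _]] := row_free_vspace fJ.
  apply: le_trans (HS H dH); apply: mule_ge0.
    by apply: integral_ge0 => x [Kx _]; rewrite lee_fin f0.
  by rewrite inve_ge0; apply: integral_ge0 => x [Lx _]; rewrite lee_fin g0.
pose ratio (v : R) := (v / kap) `^ n%:R^-1.
have ell (A : 'M[R]_n) : A \in unitmx -> K `<=` [set x *m A | x in @euclidean_ball R n] ->
    exists v : R, [/\ lebesgue_rV R n [set x *m A | x in @euclidean_ball R n] = v%:E,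
      1 <= ratio v &
      ((lebesgue_rV R n [set x *m A | x in @euclidean_ball R n] / lebesgue_rV R n K)
        `^ n%:R^-1 = (ratio v)%:E)%E].
  move=> uA KA; have [c c0 Hc] := lebesgue_rV_linear uA.
  have vE := lebesgue_ellipsoid uA c0 Hc; exists (omega n / c); split => //.
    have kv : kap <= omega n / c.
      rewrite -lee_fin -KE -vE; apply: (@le_measure _ _ _ (lebesgue_rV R n)) => //.
        by rewrite inE.
      by rewrite inE; exact: measurable_ellipsoid.
    have v1 : 1 <= omega n / c / kap by rewrite ler_pdivlMr// mul1r.
    apply: (@le_trans _ _ (1 `^ n%:R^-1)); first by rewrite powR1.
    apply: ge0_ler_powR => //; rewrite ?nnegrE ?invr_ge0//.
    exact: le_trans ler01 v1.
  by rewrite vE KE inver gt_eqF// -EFinM poweR_EFin.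
have [A0 uA0 KA0] := bounded_set_ellipsoid bK.
(* [K] lies in each competing ellipsoid, so every ratio is at least 1; together with the one
   ellipsoid given by [A0], this makes [ovr K] a positive real number. *)
have O1 : (1 <= ovr K)%E.
  apply: le_ereal_inf_tmp => _ [E [[A uA <-] KA] <-].
  by have [v [_ v1 ->]] := ell A uA KA; rewrite lee_fin.
have [w OE] : exists w : R, ovr K = w%:E.
  exists (fine (ovr K)); rewrite fineK// ge0_fin_numE; last exact: le_trans lee01 O1.
  have [v [_ _ vE]] := ell A0 uA0 KA0.
  apply: (@le_lt_trans _ _ (ratio v)%:E); last by rewrite ltry.
  rewrite -vE; apply: ereal_inf_lbound.
  exists [set x *m A0 | x in @euclidean_ball R n] => //.
  by split => //; exists A0.
have o1 : 1 <= w by move: O1; rewrite OE lee_fin.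
have o0 : 0 < w by exact: lt_le_trans o1.
rewrite IE KE OE !poweR_EFin -!EFinM -EFin_expe.
set J := (\int[_]_(x in K) _)%E; set D := I `^ _ * _.
have D0 : 0 < D by rewrite mulr_gt0// powR_gt0.
have P0 : 0 < (5 * w) ^+ k by rewrite exprn_gt0// mulr_gt0.
case: S S0 HS => [s| |//]; last by move=> _ _; rewrite gt0_muley ?lte_fin// leey.
rewrite lee_fin => s0 HS.
have J0 : (0 <= J)%E by apply: integral_ge0 => x Kx; rewrite lee_fin f0.
(* [s] may be 0, while passing from quotients to products takes a positive bound; hence [s + e]. *)
have bound (e : R) (A : 'M[R]_n) : 0 < e -> A \in unitmx ->
    K `<=` [set x *m A | x in @euclidean_ball R n] -> exists v : R, [/\ 0 < v,
      lebesgue_rV R n [set x *m A | x in @euclidean_ball R n] = v%:E &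
      (J <= ((s + e) * (5 ^+ k * (I `^ ((n - k)%:R / n%:R) * v `^ (k%:R / n%:R))))%:E)%E].
  move=> e0 uA KA; have se : 0 < s + e by rewrite ltr_wpDl.
  have [|v v0 [vE Jv]] := section_bound_set mn se uA mK mf f0 mL mg g0 g1 IE I0 KA.
    move=> H dH; apply: le_trans (HS H dH) _; rewrite lee_fin lerDl ltW//.
  by exists v; rewrite kE in Jv.
have [j JE] : exists j : R, J = j%:E.
  have [v [_ _ Jv]] := bound 1 A0 ltr01 uA0 KA0.
  by exists (fine J); rewrite fineK// ge0_fin_numE//; apply: le_lt_trans Jv _; rewrite ltry.
have j0 : 0 <= j by move: J0; rewrite JE lee_fin.
rewrite JE inver gt_eqF// -EFinM -EFinM lee_fin.
apply/ler_addgt0Pr => e e0.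
(* With this slack, [(5 w) ^+ k * (s + d)] exceeds [(5 w) ^+ k * s] by exactly [e]. *)
pose d := e / (5 * w) ^+ k.
have d0 : 0 < d by rewrite divr_gt0.
have -> : (5 * w) ^+ k * s + e = ((s + d) * 5 ^+ k) * w ^+ k.
  rewrite -[RHS]mulrA -exprMn [RHS]mulrDl [s * _]mulrC; congr (_ + _).
  by rewrite /d divfK// gt_eqF.
pose T : set R := [set t | exists (A : 'M[R]_n) (v : R), [/\ A \in unitmx,
  K `<=` [set x *m A | x in @euclidean_ball R n],
  lebesgue_rV R n [set x *m A | x in @euclidean_ball R n] = v%:E & t = ratio v]].
apply: (@le_mul_exprn_inf R k (j / D) _ w T) => //.
- by rewrite divr_ge0// ltW.
- by rewrite mulr_gt0 ?exprn_gt0// ltr_wpDl.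
- by move=> _ [A [v [_ _ _ ->]]]; exact: powR_ge0.
- move=> _ [A [v [uA KA vE ->]]].
  have [v' [v0 + Jv]] := bound d A d0 uA KA; rewrite vE => -[vv]; subst v'.
  rewrite ler_pdivrMr//; move: Jv; rewrite JE lee_fin => /le_trans; apply.
  have -> : ratio v ^+ k = v `^ (k%:R / n%:R) / kap `^ (k%:R / n%:R).
    rewrite /ratio -powR_mulrn ?powR_ge0// -powRrM [_^-1 * _]mulrC.
    rewrite powRM ?invr_ge0 ?ltW//; congr (_ * _).
    by rewrite -powR_inv1 ?ltW// -powRrM mulN1r powRN.
  have kb : kap `^ (k%:R / n%:R) != 0 by rewrite gt_eqF// powR_gt0.
  rewrite le_eqVlt; apply/orP; left; apply/eqP; rewrite /D.
  by move: kb; set z := kap `^ _ => kb; field.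
- move=> r rT; rewrite -lee_fin -OE; apply: le_ereal_inf_tmp => _ [E [[A uA <-] KA] <-].
  have [v [vE _ ->]] := ell A uA KA; rewrite lee_fin; apply: rT.
  by exists A, v.
Qed.
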